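(* Let $k\ge 1$ be an integer and $P$ a finite set of primes. Consider the set of isomorphism classes of sequences $G_k\xrightarrow{\phi_{k-1}}G_{k-1}\xrightarrow{\phi_{k-2}}\cdots\xrightarrow{\phi_1}G_1$ of finite abelian groups with all $\phi_i$ surjective, such that $|G_k|$ is divisible only by primes in $P$. Then assigning to each isomorphism class the mass $$\widetilde{\mathbf{P}}^{(k)}_P\big([G_k\twoheadrightarrow\cdots\twoheadrightarrow G_1]\big)=\frac{\prod_{p\in P}(p^{-1};p^{-1})_\infty^k}{\#\mathrm{Aut}(G_k\twoheadrightarrow\cdots\twoheadrightarrow G_1)}$$ defines a probability measure on this set. Furthermore, under this probability measure the marginal joint distribution of the isomorphism types of $G_1,\dots,G_k$ (forgetting the maps) is as follows: for all finite abelian groups $B_1,\dots,B_k$ whose orders are divisible only by primes in $P$, the probability that $G_j\simeq B_j$ for all $1\le j\le k$ equals $$\Big(\prod_{p\in P}(p^{-1};p^{-1})_\infty^k\Big)\prod_{i=1}^k\frac{\#\mathrm{Sur}(B_i,B_{i-1})}{\#\mathrm{Aut}(B_i)},\qquad B_0:=0 .$$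
   Context: An isomorphism between two sequences $(G_k\xrightarrow{\phi_{k-1}}\cdots\xrightarrow{\phi_1}G_1)$ and $(H_k\xrightarrow{\psi_{k-1}}\cdots\xrightarrow{\psi_1}H_1)$ of groups and surjections is a tuple of group isomorphisms $\varphi_i:G_i\to H_i$, $1\le i\le k$, with $\varphi_i\circ\phi_i=\psi_i\circ\varphi_{i+1}$ for all $1\le i\le k-1$. $[\,\cdot\,]$ denotes the isomorphism class of a sequence, and $\mathrm{Aut}(G_k\twoheadrightarrow\cdots\twoheadrightarrow G_1)$ is the group of isomorphisms from the sequence to itself. $\mathrm{Sur}(G,H)$ is the set of surjective group homomorphisms $G\to H$, and $(a;q)_\infty:=\prod_{i\ge 0}(1-aq^i)$. *)

(* Defs.v *)
From HB Require Import structures.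
From mathcomp Require Import all_boot all_order all_algebra all_fingroup.
From mathcomp Require Import all_solvable finmap.

Set Implicit Arguments.
Unset Strict Implicit.
Unset Printing Implicit Defensive.

Import GroupScope.

(* A finite abelian group, written multiplicatively, whose carrier is in Set.
   The isomorphism classes of sequences have to form a measurable type, and
   letting the carriers range over all of finGroupType would put that type in
   too large a universe. No isomorphism type is lost: see small_modelP. *)
Record finAbGroup := FinAbGroup {
  finab_carrier : Set;
  finab_class : FinGroup.axioms_ finab_carrier;
  finab_abelian : abelian [set: FinGroup.Pack finab_class] }.

Definition finab_group (G : finAbGroup) : finGroupType :=
  FinGroup.Pack (finab_class G).
Coercion finab_group : finAbGroup >-> finGroupType.

Definition abelian_group (G : finGroupType) : bool := abelian [set: G].

Definition isomorphic (G H : finGroupType) : bool := [set: G] \isog [set: H].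

Definition pi_group (P : {fset nat}) (G : finGroupType) : bool :=
  [pred p : nat | p \in P].-group [set: G].

Definition card_sur (G H : finGroupType) : nat :=
  #|[set f : {ffun G -> H} | morphic [set: G] f & f @: [set: G] == [set: H]]|.

Definition card_aut (G : finGroupType) : nat := #|Aut [set: G]|.

Lemma mem_codom_bij (G H : finGroupType) (f : G -> H) :
  bijective f -> forall y, y \in codom f.
Proof. by case=> g _ gK y; rewrite -[y]gK; exact: codom_f. Qed.

Lemma misom_setTP (G H : finGroupType) (f : G -> H) :
  reflect ({morph f : x y / x * y} /\ bijective f)
    (misom [set: G] [set: H] f).
Proof.
apply: (iffP misomP) => [[fM /isomP[f_inj f_im]]|[fM f_bij]].
  have fM' : {morph f : x y / x * y}.
    by move=> x y; apply: (morphicP fM); rewrite inE.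
  split=> //; apply: inj_card_bij => [x y fxy|].
    by apply: (injmP f_inj); rewrite ?inE.
  by rewrite -!cardsT -f_im morphimEdom leq_imset_card.
have fM' : morphic [set: G] f by apply/morphicP => x y _ _; exact: fM.
exists fM'; apply/isomP; split.
  by apply/injmP => x y _ _; exact: (bij_inj f_bij).
apply/setP => y; rewrite morphimEdom inE; apply/imsetP.
by case: f_bij => g _ gK; exists (g y); rewrite ?inE //= gK.
Qed.

Section SmallModel.
Variable gT : finGroupType.

Definition small : Set := {i : nat | i < #|gT|}.

Definition to_small (x : gT) : small :=
  exist _ (nat_of_ord (enum_rank x)) (ltn_ord _).

Definition of_small (u : small) : gT := enum_val (Ordinal (svalP u)).

Lemma to_smallK : cancel to_small of_small.
Proof.
by move=> x; rewrite /of_small -[RHS]enum_rankK; congr enum_val; exact: val_inj.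
Qed.

Lemma of_smallK : cancel of_small to_small.
Proof. by move=> u; apply: val_inj; rewrite /= /of_small enum_valK. Qed.

HB.instance Definition _ := Finite.copy small (can_type of_smallK).

Definition small_mul (u v : small) : small :=
  to_small (of_small u * of_small v).

Definition small_inv (u : small) : small := to_small (of_small u)^-1.

Lemma small_mulA : associative small_mul.
Proof. by move=> u v w; rewrite /small_mul !to_smallK mulgA. Qed.

Lemma small_mul1 : left_id (to_small 1) small_mul.
Proof. by move=> u; rewrite /small_mul to_smallK mul1g of_smallK. Qed.

Lemma small_mulV : left_inverse (to_small 1) small_inv small_mul.
Proof. by move=> u; rewrite /small_mul to_smallK mulVg. Qed.

HB.instance Definition _ :=
  Finite_isGroup.Build small small_mulA small_mul1 small_mulV.

Lemma small_isog : [set: gT] \isog [set: small].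
Proof.
have mf : {in [set: gT] &, {morph to_small : x y / x * y}}.
  have smallM (u v : small) : u * v = small_mul u v by [].
  by move=> x y _ _; rewrite smallM /small_mul !to_smallK.
apply/isogP; exists (Morphism mf).
  by apply/injmP => x y _ _ /=; exact: (can_inj to_smallK).
apply/setP => u; rewrite morphimEdom inE; apply/imsetP.
by exists (of_small u); rewrite ?inE //= of_smallK.
Qed.

Lemma small_abelian : abelian [set: gT] -> abelian [set: small].
Proof. by rewrite (isog_abelian small_isog). Qed.

End SmallModel.

Definition small_model (gT : finGroupType) (gT_ab : abelian [set: gT]) :
  finAbGroup := FinAbGroup (small_abelian gT_ab).

Lemma small_modelP (gT : finGroupType) (gT_ab : abelian [set: gT]) :
  isomorphic gT (small_model gT_ab).
Proof. exact: small_isog. Qed.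

(* The sequence G_k ->> ... ->> G_1, with G_(i+1) stored at index i : 'I_k.
   When j is the successor of i, absurj is the map phi_(i+1) from G_(i+2) to
   G_(i+1). The condition abseq_pi is about G_k only. *)
Record abseq (k : nat) (P : {fset nat}) := AbSeq {
  abgrp :> 'I_k -> finAbGroup;
  absurj : forall i j : 'I_k,
    j = i.+1 :> nat -> {morphism [set: abgrp j] >-> abgrp i};
  absurjP : forall (i j : 'I_k) (ij : j = i.+1 :> nat),
    absurj ij @* [set: abgrp j] = [set: abgrp i];
  abseq_pi : forall i : 'I_k,
    i.+1 = k -> pi_group P (abgrp i) }.

Section Isomorphisms.
Variables (k : nat) (P : {fset nat}).
Implicit Types G H : abseq k P.

Definition is_seqiso G H (f : forall i : 'I_k, G i -> H i) : Prop :=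
  (forall i, misom [set: G i] [set: H i] (f i)) /\
  (forall (i j : 'I_k) (ij : j = i.+1 :> nat) (x : G j),
     f i (absurj G ij x) = absurj H ij (f j x)).

Definition seqiso G H : Prop := exists f, @is_seqiso G H f.

Lemma seqiso_refl G : seqiso G G.
Proof.
exists (fun i => id); split=> // i; apply/misom_setTP.
by split=> //; exists id.
Qed.

Lemma seqiso_sym G H : seqiso G H -> seqiso H G.
Proof.
case=> f [fi fc].
have fX i : {g : H i -> G i | cancel (f i) g & cancel g (f i)}.
  have /misom_setTP[_ f_bij] := fi i.
  exists (fun y => iinv (mem_codom_bij f_bij y)).
    by move=> x; apply: (bij_inj f_bij); exact: f_iinv.
  by move=> y; exact: f_iinv.
exists (fun i => s2val (fX i)); split=> [i|i j ij y].
  have /misom_setTP[fM _] := fi i; case: (fX i) => g fgK gfK /=.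
  apply/misom_setTP; split; last by exists (f i).
  by move=> x y; apply: (can_inj fgK); rewrite fM !gfK.
case: (fX i) (fX j) => g fgK gfK [g' fgK' gfK'] /=.
by apply: (can_inj fgK); rewrite gfK fc gfK'.
Qed.

Lemma seqiso_trans G H K : seqiso G H -> seqiso H K -> seqiso G K.
Proof.
move=> [f [fi fc]] [g [gi gc]]; exists (fun i => g i \o f i); split.
  move=> i; have /misom_setTP[fM f_bij] := fi i.
  have /misom_setTP[gM g_bij] := gi i.
  apply/misom_setTP; split; last exact: bij_comp.
  by move=> x y; rewrite /= fM gM.
by move=> i j ij x; rewrite /= fc gc.
Qed.

Lemma trivial_abelian : abelian [set: {perm 'I_0}].
Proof. by apply/centsP => x _ y _; apply/permP => -[]. Qed.

Definition trivial_group : finAbGroup := small_model trivial_abelian.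

Lemma trivial_setT (x : trivial_group) : x = 1.
Proof.
apply/set1P; suff -> : [set 1] = [set: trivial_group] by rewrite inE.
apply/eqP; rewrite eqEcard subsetT -(card_isog (small_modelP trivial_abelian)).
by rewrite cards1 cardsT card_Sn.
Qed.

Lemma trivial_surj (i j : 'I_k) (ij : j = i.+1 :> nat) :
  idm [set: trivial_group] @* [set: trivial_group] = [set: trivial_group].
Proof. exact: morphim_idm. Qed.

Lemma trivial_pi (i : 'I_k) :
  i.+1 = k -> pi_group P trivial_group.
Proof.
move=> _; rewrite /pi_group.
suff -> : [set: trivial_group] = 1 by exact: pgroup1.
by apply/setP => x; rewrite !inE [x]trivial_setT eqxx.
Qed.

Definition trivial_abseq : abseq k P :=
  @AbSeq k P (fun=> trivial_group)
    (fun _ _ _ => idm_morphism [set: trivial_group]) trivial_surj trivial_pi.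

End Isomorphisms.

From mathcomp Require Import all_classical all_reals all_analysis.
Import Order.TTheory GRing.Theory Num.Theory.
Local Open Scope classical_set_scope.
Local Open Scope ring_scope.

Definition card_seqaut (k : nat) (P : {fset nat}) (G : abseq k P) : nat :=
  #|[pred f : {dffun forall i : 'I_k, {ffun G i -> G i}} |
     `[< is_seqiso (G := G) (H := G) (fun i => f i) >]]|.

Record isoclass (k : nat) (P : {fset nat}) := IsoClass {
  class_elts : set (abseq k P);
  class_eltsP : exists G : abseq k P, class_elts = [set H | seqiso G H] }.

Definition isoclass_of (k : nat) (P : {fset nat}) (G : abseq k P) :
  isoclass k P := IsoClass (ex_intro _ G erefl).

Lemma isoclass_ofP (k : nat) (P : {fset nat}) (G H : abseq k P) :
  isoclass_of G = isoclass_of H <-> seqiso G H.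
Proof.
split=> [[GH]|GH].
  have : [set K | seqiso H K] H by exact: seqiso_refl.
  by rewrite -GH.
suff GHE : class_elts (isoclass_of G) = class_elts (isoclass_of H).
  move: (isoclass_of G) (isoclass_of H) GHE => [c cP] [d dP] /= cd.
  by case: _ / cd dP => dP; congr IsoClass; exact: Prop_irrelevance.
apply/seteqP; split=> K /=; apply: seqiso_trans => //.
exact: seqiso_sym.
Qed.

HB.instance Definition _ (k : nat) (P : {fset nat}) :=
  gen_eqMixin (isoclass k P).
HB.instance Definition _ (k : nat) (P : {fset nat}) :=
  gen_choiceMixin (isoclass k P).
HB.instance Definition _ (k : nat) (P : {fset nat}) :=
  isPointed.Build (isoclass k P) (isoclass_of (trivial_abseq k P)).
HB.instance Definition _ (k : nat) (P : {fset nat}) :=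
  @isMeasurable.Build default_measure_display (isoclass k P)
    discrete_measurable discrete_measurable0
    discrete_measurableC discrete_measurableU.

Definition qpoch (R : realType) (a q : R) : R :=
  limn (fun n : nat => \prod_(0 <= i < n) (1 - a * q ^+ i)).

Definition cl_const (R : realType) (k : nat) (P : {fset nat}) : R :=
  \prod_(p <- P) qpoch p%:R^-1 p%:R^-1 ^+ k.

Lemma qpoch_is_cvg (R : realType) (a q : R) : 0 <= a <= 1 -> 0 <= q <= 1 ->
  cvgn (fun n : nat => \prod_(0 <= i < n) (1 - a * q ^+ i)).
Proof.
move=> /andP[a0 a1] /andP[q0 q1].
have t0 i : 0 <= 1 - a * q ^+ i <= 1.
  rewrite subr_ge0 mulr_ile1 ?exprn_ge0 ?exprn_ile1 //=.
  by rewrite gerBl mulr_ge0 ?exprn_ge0.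
have p0 n : 0 <= \prod_(0 <= i < n) (1 - a * q ^+ i).
  by apply: prodr_ge0 => i _; case/andP: (t0 i).
apply: nonincreasing_is_cvgn; last first.
  by exists 0 => _ [n _ <-]; exact: p0.
apply/nonincreasing_seqP => n; rewrite big_nat_recr //=.
by rewrite ler_piMr //; case/andP: (t0 n).
Qed.

(* Main.v *)
Require Import Defs.
From HB Require Import structures.
From mathcomp Require Import all_boot all_order all_algebra all_fingroup.
From mathcomp Require Import all_solvable finmap lra.
From mathcomp Require Import all_classical all_reals all_analysis.

(** A finite abelian group with [n] marked generators has no automorphism, and
    it is determined by the set of pairs of words in the generators with equal
    values. Adding a generator [g] to a marked group [A] amounts to choosing
    the least [d > 0] with [g ^+ d] in [A], and the element [x = g ^+ d] of
    [A]: there are [#|A|] choices for each [d]. Hence the sum of [#|G| ^- n]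
    over the [G] with [n] marked generators and with order a product of
    primes in [P] is [\prod_(1 <= j <= n) zeta_P j]. If moreover the generators
    have to be sent to given elements of [H] by a morphism, the sum is divided
    by the [n]-th power of the order of the subgroup that they generate.
    Forgetting the marking turns this into
      [\sum_G #Sur(G, H) / #Aut(G) * (proportion of generating n-tuples in G)
       = (proportion of generating n-tuples in H) * \prod_(j <= n) zeta_P j],
    and for [n] tending to infinity [\sum_G #Sur(G, H) / #Aut(G)] is the same
    constant [\prod_p (p^-1; p^-1)^-1] for every [H]. On the other hand
    orbit counting for [\prod_i Aut(B_i)] acting on [\prod_i Sur(B_i, B_(i-1))]
    gives the total mass of the sequences of types [B_k, ..., B_1], and summing
    these products over [B_k], then [B_(k-1)], and so on, gives total mass
    [1]. *)

Local Open Scope classical_set_scope.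
Local Open Scope ring_scope.

Set Implicit Arguments.
Unset Strict Implicit.
Unset Printing Implicit Defensive.

(** * Words and marked groups *)

Section Words.
Import GroupScope.

(* A letter outside of the range of [s] has value 1. *)
Definition wordval (gT : finGroupType) (s : seq gT) (w : seq nat) : gT :=
  (\prod_(i <- w) nth 1 s i)%g.

Definition generates (gT : finGroupType) (s : seq gT) : bool :=
  (<<[set x in s]>> == [set: gT])%SET.

Lemma wordval_cat (gT : finGroupType) (s : seq gT) v w :
  wordval s (v ++ w) = wordval s v * wordval s w.
Proof. by rewrite /wordval big_cat. Qed.

Lemma wordval_letter (gT : finGroupType) (s : seq gT) i :
  wordval s [:: i] = nth 1 s i.
Proof. by rewrite /wordval big_seq1. Qed.

Lemma wordval_cons (gT : finGroupType) (s : seq gT) i w :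
  wordval s (i :: w) = nth 1 s i * wordval s w.
Proof. by rewrite /wordval big_cons. Qed.

Lemma wordval_nil (gT : finGroupType) (s : seq gT) : wordval s [::] = 1.
Proof. by rewrite /wordval big_nil. Qed.

Lemma morph1_of_morph (gT rT : finGroupType) (f : gT -> rT) :
  {morph f : x y / x * y} -> f 1 = 1.
Proof. by move=> fM; apply: (mulgI (f 1)); rewrite -fM !mulg1. Qed.

Lemma morphX_of_morph (gT rT : finGroupType) (f : gT -> rT) x n :
  {morph f : x y / x * y} -> f (x ^+ n) = f x ^+ n.
Proof.
move=> fM; elim: n => [|n IHn]; first by rewrite !expg0 morph1_of_morph.
by rewrite !expgS fM IHn.
Qed.

Lemma wordval_map (gT rT : finGroupType) (f : gT -> rT) s w :
  {morph f : x y / x * y} -> wordval (map f s) w = f (wordval s w).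
Proof.
move=> fM; elim: w => [|i w IHw]; first by rewrite !wordval_nil morph1_of_morph.
rewrite !wordval_cons IHw fM; congr (_ * _).
have [si|si] := ltnP i (size s); first by rewrite (nth_map 1).
by rewrite !nth_default ?size_map // morph1_of_morph.
Qed.

(** In a finite group the products of generators already form the generated subgroup, so positive
    words reach all of it. *)
Lemma mem_gen_wordval (gT : finGroupType) (s : seq gT) x :
  (x \in <<[set y in s]%SET>>) <-> exists w, wordval s w = x.
Proof.
split=> [/gen_prodgP[n [c cs ->]]|[w <-]].
  exists [seq index (c i) s | i <- index_enum 'I_n].
  rewrite /wordval big_map; apply: eq_bigr => i _; rewrite nth_index //.
  by have := cs i; rewrite inE.
elim: w => [|i w IHw]; rewrite ?wordval_nil ?group1 // wordval_cons groupM //.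
have [si|si] := ltnP i (size s); last by rewrite nth_default ?group1.
by apply: mem_gen; rewrite inE mem_nth.
Qed.

Lemma generatesP (gT : finGroupType) (s : seq gT) :
  reflect (forall x, exists w, wordval s w = x) (generates s).
Proof.
apply: (iffP eqP) => [sT x|sT]; first by apply/mem_gen_wordval; rewrite sT inE.
by apply/setP => x; rewrite [RHS]inE; apply/mem_gen_wordval.
Qed.

Lemma generates_ext (gT rT : finGroupType) (f g : gT -> rT) s :
  {morph f : x y / x * y} -> {morph g : x y / x * y} -> generates s ->
  map f s = map g s -> f =1 g.
Proof.
move=> fM gM /generatesP sT fg x; have [w <-] := sT x.
by rewrite -!wordval_map // fg.
Qed.

(** The morphism evaluates on [t] any word whose value on [s] is the given element; the inclusion of
    relations makes the result independent of the chosen word. *)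
Lemma wordval_morph (gT rT : finGroupType) (s : seq gT) (t : seq rT) :
  generates s -> size s = size t ->
  (forall v w, wordval s v = wordval s w -> wordval t v = wordval t w) ->
  exists2 f : gT -> rT, {morph f : x y / x * y} & map f s = t.
Proof.
move=> /generatesP sT st st_ker.
have [word wordK] := choice sT.
have fE w : wordval t (word (wordval s w)) = wordval t w.
  by apply: st_ker; rewrite wordK.
exists (fun x => wordval t (word x)) => [x y|].
  by rewrite -wordval_cat -[in LHS](wordK x) -[in LHS](wordK y) -wordval_cat fE.
apply: (eq_from_nth (x0 := 1)); rewrite ?size_map // => i si.
by rewrite (nth_map 1) // -wordval_letter fE wordval_letter.
Qed.

Lemma generates_map (gT rT : finGroupType) (f : gT -> rT) s :
  {morph f : x y / x * y} -> (forall y, exists x, f x = y) ->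
  generates s -> generates (map f s).
Proof.
move=> fM f_surj /generatesP sT; apply/generatesP => y.
have [x <-] := f_surj y; have [w <-] := sT x.
by exists w; rewrite wordval_map.
Qed.

End Words.

(** * Adding one generator to a finite abelian group *)

Section CyclicExtensions.
Import GroupScope.

(** Here [d] is the order of [g] modulo the image of [i]; the pair [(d, x)] is the invariant that
    classifies the ways of adding a generator to [aT]. *)
Definition cyclic_ext (aT gT : finGroupType) (i : aT -> gT) (g : gT)
    (d : nat) (x : aT) : Prop :=
  [/\ (0 < d)%N, g ^+ d = i x & forall a y, g ^+ a = i y -> (d %| a)%N].

(** For a word in [g :: s], what remains in the letters of [s] after all the powers of [g] are
    collected in front. *)
Definition wtail (w : seq nat) : seq nat := [seq i.-1 | i <- w & i != 0%N].

(* The kernel of the evaluation at [g :: map i s] when [cyclic_ext i g d x]: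
   [g ^+ a * i y] is determined by [a %% d] and [x ^+ (a %/ d) * y]. *)
Definition extker (aT : finGroupType) (s : seq aT) (d : nat) (x : aT)
    (v w : seq nat) : Prop :=
  count_mem 0%N v = count_mem 0%N w %[mod d] /\
  x ^+ (count_mem 0%N v %/ d) * wordval s (wtail v) =
  x ^+ (count_mem 0%N w %/ d) * wordval s (wtail w).

Lemma abelian_mulgC (gT : finGroupType) (x y : gT) :
  abelian_group gT -> x * y = y * x.
Proof. by move/centsP; apply; rewrite inE. Qed.

Lemma wordval_wtail (gT : finGroupType) (g : gT) s w : abelian_group gT ->
  wordval (g :: s) w = g ^+ count_mem 0%N w * wordval s (wtail w).
Proof.
move=> gT_ab; elim: w => [|[|i] w IHw]; rewrite /wtail /=.
- by rewrite !wordval_nil mulg1.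
- by rewrite wordval_cons IHw /= add1n expgS mulgA.
rewrite wordval_cons IHw /= add0n wordval_cons !mulgA; congr (_ * _).
exact: abelian_mulgC.
Qed.

Lemma wtail_cat v w : wtail (v ++ w) = wtail v ++ wtail w.
Proof. by rewrite /wtail filter_cat map_cat. Qed.

Lemma wtail_succ w : wtail (map succn w) = w.
Proof.
rewrite /wtail filter_map /= (eq_filter (a2 := predT)) // filter_predT.
by rewrite -map_comp map_id.
Qed.

Lemma count_mem_succ w : count_mem 0%N (map succn w) = 0%N.
Proof. by rewrite count_map (eq_count (a2 := pred0)) ?count_pred0. Qed.

Lemma wtail_nseq a : wtail (nseq a 0%N) = [::].
Proof. by rewrite /wtail filter_nseq. Qed.

Lemma count_mem_nseq0 a : count_mem 0%N (nseq a 0%N) = a.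
Proof. by rewrite count_nseq /= mul1n. Qed.

Section Ext.
Variables (aT gT : finGroupType) (i : aT -> gT) (g : gT) (d : nat) (x : aT).
Hypotheses (gT_ab : abelian_group gT) (iM : {morph i : x y / x * y}).
Hypotheses (i_inj : injective i) (ext : cyclic_ext i g d x).

Lemma cyclic_ext_nf a y :
  g ^+ a * i y = g ^+ (a %% d) * i (x ^+ (a %/ d) * y).
Proof.
have [_ gd _] := ext; rewrite {1}(divn_eq a d) addnC expgD mulnC expgM gd.
by rewrite iM (morphX_of_morph _ _ iM) mulgA.
Qed.

(** For [a <= b], equal values put [g ^+ (b - a)] in the image of [i], so [d] divides [b - a], which
    is smaller than [d]. *)
Lemma cyclic_ext_uniq a b y z : (a < d)%N -> (b < d)%N ->
  g ^+ a * i y = g ^+ b * i z -> a = b /\ y = z.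
Proof.
wlog ab : a b y z / (a <= b)%N => [hw ad bd E|ad bd E].
  have [ab|/ltnW ba] := leqP a b; first exact: hw.
  by have [-> ->] := hw _ _ _ _ ba bd ad (esym E).
suff ab' : a = b.
  by split=> //; apply: i_inj; apply: (mulgI (g ^+ a)); rewrite E ab'.
have [_ _ gd] := ext.
have : g ^+ (b - a) = i (y * z^-1).
  have iV u : i u^-1 = (i u)^-1.
    by apply: (mulgI (i u)); rewrite -iM !mulgV morph1_of_morph.
  apply: (mulgI (g ^+ a)); rewrite -expgD subnKC // iM iV mulgA E.
  by rewrite mulgK.
move/gd; have : (b - a < d)%N by rewrite (leq_ltn_trans _ bd) ?leq_subr.
move=> ltd; rewrite /dvdn modn_small // subn_eq0 => ba.
by apply/eqP; rewrite eqn_leq ab ba.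
Qed.

Lemma cyclic_ext_eq a b y z :
  g ^+ a * i y = g ^+ b * i z <->
  a = b %[mod d] /\ x ^+ (a %/ d) * y = x ^+ (b %/ d) * z.
Proof.
have d0 : (0 < d)%N by case: ext.
rewrite (cyclic_ext_nf a) (cyclic_ext_nf b); split=> [|[-> ->]] //.
by apply: cyclic_ext_uniq; rewrite ltn_mod.
Qed.

Lemma cyclic_ext_ker s v w :
  wordval (g :: map i s) v = wordval (g :: map i s) w <-> extker s d x v w.
Proof. by rewrite !wordval_wtail // !wordval_map //; exact: cyclic_ext_eq. Qed.

Lemma cyclic_ext_span s : generates (g :: map i s) ->
  forall u, exists a y, u = g ^+ a * i y.
Proof.
move=> /generatesP gsT u; have [w <-] := gsT u.
by rewrite wordval_wtail // wordval_map //; eexists _, _.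
Qed.

(** Each element has exactly one normal form [g ^+ a * i y] with [a < d]. *)
Lemma cyclic_ext_card :
  (forall u, exists a y, u = g ^+ a * i y) -> #|gT| = (d * #|aT|)%N.
Proof.
move=> span; rewrite -[d in RHS]card_ord -card_prod.
have d0 : (0 < d)%N by case: ext.
pose f (u : 'I_d * aT) := g ^+ u.1 * i u.2.
have f_inj : injective f.
  move=> [a y] [b z] /cyclic_ext_uniq /=.
  case; rewrite ?ltn_ord // => ab ->; congr (_, _); exact: val_inj.
have <- : #|codom f| = #|{: 'I_d * aT}| by rewrite card_codom.
apply: eq_card => z; rewrite [LHS]inE; apply/esym; apply/codomP.
have [a [y ->]] := span z; rewrite cyclic_ext_nf.
by eexists (Ordinal (ltn_pmod a d0), _).
Qed.

Lemma cyclic_ext_generates s : generates s ->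
  (forall u, exists a y, u = g ^+ a * i y) -> generates (g :: map i s).
Proof.
move=> /generatesP sT span; apply/generatesP => z.
have [a [y ->]] := span z.
have [w <-] := sT y; exists (nseq a 0%N ++ map succn w).
have tE : wtail (nseq a 0%N ++ map succn w) = w.
  by rewrite wtail_cat wtail_nseq wtail_succ.
rewrite wordval_wtail // tE wordval_map // count_cat count_mem_nseq0.
by rewrite count_mem_succ addn0.
Qed.

End Ext.
(** Take the least positive exponent that brings [g] into the image; a nonzero remainder of another
    such exponent would be a smaller one. *)
Lemma cyclic_ext_type (aT gT : finGroupType) (i : aT -> gT) (g : gT) :
  {morph i : x y / x * y} -> injective i -> exists d x, cyclic_ext i g d x.
Proof.
move=> iM i_inj.
have exd : exists n, (0 < n)%N && (g ^+ n \in codom i).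
  exists #[g]; rewrite order_gt0 expg_order -(morph1_of_morph iM).
  exact: codom_f.
case: (ex_minnP exd) => d /andP[d0 /codomP[x gx]] d_min.
exists d, x; split=> // a y.
rewrite {1}(divn_eq a d) addnC expgD mulnC expgM gx.
rewrite -(morphX_of_morph _ _ iM) => /(congr1 (mulg^~ (i (x ^+ (a %/ d))^-1))).
rewrite -mulgA -!iM mulgV (morph1_of_morph iM) mulg1 => gE.
rewrite /dvdn; apply: contraT; rewrite -lt0n => r0.
have := d_min (a %% d)%N; rewrite r0 gE codom_f => /(_ isT).
by rewrite leqNgt ltn_mod d0.
Qed.

(** The extension is the quotient of a cyclic group times [aT] by the relation that identifies the
    [d]-th power of the cyclic generator with [x]. Giving that generator order [d * #[x]] keeps [aT]
    embedded: if the [m]-th power of the relator is trivial in the cyclic factor, then [#[x]]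
    divides [m] and it is trivial in [aT] too. *)
Lemma cyclic_ext_exists (aT : finGroupType) (d : nat) (x : aT) :
  abelian_group aT -> (0 < d)%N ->
  exists (gT : finGroupType) (i : aT -> gT) (g : gT),
    [/\ abelian_group gT, {morph i : x y / x * y}, injective i,
        cyclic_ext i g d x & forall u, exists a y, u = g ^+ a * i y].
Proof.
move=> aT_ab d0; have [N NE] : exists N, N.+1 = (d * #[x])%N.
  by exists (d * #[x]).-1; rewrite prednK // muln_gt0 d0 order_gt0.
pose z : 'I_N.+1 := Zp1; have zo : #[z] = (d * #[x])%N by rewrite order_Zp1.
pose E : finGroupType := ('I_N.+1 * aT)%type.
have E_ab (u v : E) : u * v = v * u.
  apply/eqP; rewrite /eq_op /=; apply/andP; split; apply/eqP.
    exact: Zp_mulgC.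
  exact: abelian_mulgC.
pose c : E := (z ^+ d, x^-1).
pose C : {group E} := <[c]>%G.
have inN u : u \in 'N(C).
  have CC : u \in 'C(C) by apply/centP => v _; exact: E_ab.
  exact: (fintype.subsetP (cent_sub C) _ CC).
pose q u : coset_of C := coset C u.
have qM : {morph q : u v / u * v} by move=> u v; rewrite /q morphM ?inN.
have q_eq u v : q u = q v <-> exists m, u = c ^+ m * v.
  split=> [/rcoset_kercosetP|[m ->]].
    by move=> /(_ (inN u) (inN v)) /rcosetP[_ /cycleP[m ->] ->]; exists m.
  by apply: coset_kerl; exact: mem_cycle.
have pairX (a : 'I_N.+1) (b : aT) n : ((a, b) : E) ^+ n = (a ^+ n, b ^+ n).
  elim: n => [|n IHn]; first by rewrite !expg0.
  by rewrite !expgS IHn.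
have cX m : c ^+ m = (z ^+ (d * m), x^-1 ^+ m) by rewrite pairX -expgM.
have pairM (a a' : 'I_N.+1) (b b' : aT) :
  ((a, b) : E) * (a', b') = (a * a', b * b') by [].
have Lo m n : z ^+ m = z ^+ n -> m = n %[mod d * #[x]].
  by move=> /eqP; rewrite eq_expg_mod_order zo => /eqP.
exists (coset_of C), (fun y => q (1, y)), (q (z, 1)); split.
- apply/centsP => u _ v _; have [u' _ ->] := cosetP u.
  by have [v' _ ->] := cosetP v; rewrite /commute -!qM E_ab.
- by move=> y y'; rewrite -qM pairM mulg1.
- move=> y y' /q_eq[m]; rewrite cX pairM mulg1 => -[/(Lo 0%N) m0 ->].
  suff -> : x^-1 ^+ m = 1 by rewrite mul1g.
  have : (d * #[x] %| d * m)%N by rewrite /dvdn -m0 mod0n.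
  by rewrite dvdn_pmul2l // order_dvdn expgVn => /eqP->; rewrite invg1.
- split=> // [|a y].
    rewrite -(morphX_of_morph _ _ qM) pairX; apply/q_eq; exists 1%N.
    by rewrite cX pairM !muln1 expg1n mulg1 expg1 mulVg.
  rewrite -(morphX_of_morph _ _ qM) pairX => /q_eq[m].
  rewrite cX pairM mulg1 => -[/Lo am _].
  have : (d %| d * m)%N by exact: dvdn_mulr.
  rewrite /dvdn -(modn_dvdm _ (dvdn_mulr #[x] (dvdnn d))) -am.
  by rewrite modn_dvdm ?dvdn_mulr.
move=> u; have [[a y] _ ->] := cosetP u.
have : a \in <[z]> by rewrite -Zp_cycle inE.
move=> /cycleP[m ->]; exists m, y.
by rewrite -(morphX_of_morph _ _ qM) pairX -qM pairM expg1n mulg1 mul1g.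
Qed.

End CyclicExtensions.

(** * Kernels of generating tuples, and the counts they give *)

Section GeneratingTuples.
Import GroupScope.

(** The type of this set of pairs does not mention [gT], so that marked groups with different
    carriers can be compared and collected in one set. *)
Definition wker (gT : finGroupType) (s : seq gT) : set (seq nat * seq nat) :=
  [set vw | wordval s vw.1 = wordval s vw.2]%classic.

Definition gens (n : nat) (gT : finGroupType) : {set n.-tuple gT} :=
  [set s : n.-tuple gT | generates s]%SET.

Lemma wker_morph (gT rT : finGroupType) (s : seq gT) (t : seq rT) :
  generates s -> size s = size t -> (wker s `<=` wker t)%classic ->
  exists2 f : gT -> rT, {morph f : x y / x * y} & map f s = t.
Proof.
by move=> sT st kst; apply: wordval_morph => // v w vw; exact: (kst (v, w)).
Qed.

Lemma wker_map (gT rT : finGroupType) (f : gT -> rT) s :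
  {morph f : x y / x * y} -> (wker s `<=` wker (map f s))%classic.
Proof. by move=> fM [v w]; rewrite /wker /= !wordval_map // => ->. Qed.

Lemma wker_map_inj (gT rT : finGroupType) (f : gT -> rT) s :
  {morph f : x y / x * y} -> injective f -> wker (map f s) = wker s.
Proof.
move=> fM f_inj; apply/seteqP; split; last exact: wker_map.
by move=> [v w]; rewrite /wker /= !wordval_map // => /f_inj.
Qed.

Lemma isomorphicP (gT rT : finGroupType) :
  isomorphic gT rT <->
  exists2 f : gT -> rT, {morph f : x y / x * y} & bijective f.
Proof.
split=> [/existsP[f /misom_setTP[fM fb]]|[f fM fb]]; first by exists f.
apply/existsP; exists [ffun x => f x]; apply/misom_setTP; split.
  by move=> x y; rewrite !ffunE.
case: fb => g fK gK; by exists g => x; rewrite ffunE ?fK ?gK.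
Qed.

Lemma isomorphic_refl (gT : finGroupType) : isomorphic gT gT.
Proof. exact: isog_refl. Qed.

Lemma isomorphic_sym (gT rT : finGroupType) :
  isomorphic gT rT -> isomorphic rT gT.
Proof. by rewrite /isomorphic isog_sym. Qed.

Lemma isomorphic_trans (gT rT uT : finGroupType) :
  isomorphic gT rT -> isomorphic rT uT -> isomorphic gT uT.
Proof. exact: isog_trans. Qed.

(** Inclusion of kernels both ways gives morphisms both ways, and their composites fix the
    generators. *)
Lemma wker_iso (gT rT : finGroupType) (s : seq gT) (t : seq rT) :
  generates s -> generates t -> size s = size t -> wker s = wker t ->
  exists f : gT -> rT,
    [/\ {morph f : x y / x * y}, bijective f & map f s = t].
Proof.
move=> sT tT st kst.
have [f fM fs] : exists2 f : gT -> rT, {morph f : x y / x * y} & map f s = t.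
  by apply: wker_morph => //; rewrite kst.
have [g gM gt] : exists2 g : rT -> gT, {morph g : x y / x * y} & map g t = s.
  by apply: wker_morph => //; rewrite kst.
exists f; split=> //; exists g.
  apply: (@generates_ext _ _ (g \o f) id s) => //=.
    by move=> x y /=; rewrite fM gM.
  by rewrite map_comp fs gt map_id.
apply: (@generates_ext _ _ (f \o g) id t) => //=.
  by move=> x y /=; rewrite gM fM.
by rewrite map_comp gt fs map_id.
Qed.

Lemma generates_bij (gT rT : finGroupType) (f : gT -> rT) s :
  {morph f : x y / x * y} -> bijective f -> generates s ->
  generates (map f s).
Proof.
move=> fM [g fK gK]; apply: generates_map => // y.
by exists (g y).
Qed.

Lemma mem_Aut_setT (gT : finGroupType) (a : {perm gT}) :
  reflect {morph a : x y / x * y} (a \in Aut [set: gT]%SET).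
Proof.
apply: (iffP idP) => [/Aut_morphic/morphicP aM x y|aM].
  by apply: aM; rewrite inE.
by rewrite inE; apply/andP; split; [apply/fintype.subsetP => x; rewrite inE|
   apply/morphicP => x y _ _; exact: aM].
Qed.

(** The automorphisms act freely on generating tuples, and two of these have the same kernel exactly
    when they lie in one orbit. *)
Lemma card_gens_wker (n : nat) (gT : finGroupType) (s : n.-tuple gT) :
  s \in gens n gT ->
  #|[set t in gens n gT | `[< wker t = wker s >]]%SET| = card_aut gT.
Proof.
rewrite inE => sT.
rewrite /card_aut -(card_in_imset (f := fun a : {perm gT} => map_tuple a s)).
  apply: eq_card => t; rewrite !inE; apply/andP/imsetP.
    move=> [tT /asboolP ts].
    have [f [fM fb fs]] : exists f : gT -> gT,
        [/\ {morph f : x y / x * y}, bijective f & map f s = t].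
      by apply: wker_iso; rewrite ?size_tuple.
    exists (perm (bij_inj fb)).
      by apply/mem_Aut_setT => x y; rewrite !permE.
    by apply: val_inj; rewrite /= -fs; apply: eq_map => x; rewrite permE.
  move=> [a /mem_Aut_setT aM ->]; split.
    apply: generates_bij => //; exact: injF_bij (@perm_inj _ a).
  by apply/asboolP; rewrite /= wker_map_inj //; exact: perm_inj.
move=> a b /mem_Aut_setT aM /mem_Aut_setT bM /(congr1 val) /= ab.
by apply/permP; exact: generates_ext ab.
Qed.

(** A surjection is determined by the images of the generators [s]; a generating tuple [t] arises in
    this way exactly when it satisfies all the relations of [s]. *)
Lemma card_sur_gens (n : nat) (gT rT : finGroupType) (s : n.-tuple gT) :
  s \in gens n gT ->
  #|[set t in gens n rT | `[< (wker s `<=` wker t)%classic >]]%SET| =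
  card_sur gT rT.
Proof.
rewrite inE => sT.
have surP (f : {ffun gT -> rT}) : reflect
    ({morph f : x y / x * y} /\ forall y, exists x, f x = y)
    (morphic [set: gT]%SET f && (f @: [set: gT]%SET == [set: rT]%SET)).
  apply: (iffP andP) => [[/morphicP fM /eqP fT]|[fM fT]].
    split=> [x y|y]; first by apply: fM; rewrite inE.
    have : y \in f @: [set: gT]%SET by rewrite fT inE.
    by case/imsetP => x _ ->; exists x.
  split; first by apply/morphicP => x y _ _; exact: fM.
  apply/eqP/setP => y; rewrite [RHS]inE; apply/imsetP.
  by have [x <-] := fT y; exists x.
rewrite /card_sur
  -(card_in_imset (f := fun f : {ffun gT -> rT} => map_tuple f s)).
  apply: eq_card => t; rewrite !inE; apply/andP/imsetP.
    move=> [tT /asboolP ts].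
    have [f fM fs] : exists2 f : gT -> rT,
        {morph f : x y / x * y} & map f s = t.
      by apply: wker_morph; rewrite ?size_tuple.
    exists [ffun x => f x].
      rewrite inE; apply/surP; split=> [x y|y]; first by rewrite !ffunE.
      move/generatesP: tT => /(_ y)[w <-]; exists (wordval s w).
      by rewrite ffunE -wordval_map // fs.
    by apply: val_inj; rewrite /= -fs; apply: eq_map => x; rewrite ffunE.
  move=> [f]; rewrite inE => /surP[fM fT] ->; split.
    exact: generates_map.
  by apply/asboolP; exact: wker_map.
move=> f g; rewrite !inE => /surP[fM _] /surP[gM _] /(congr1 val) /= fg.
by apply/ffunP; exact: generates_ext fg.
Qed.

Lemma card_subg_of (gT : finGroupType) (M : {group gT}) :
  #|{: subg_of M}| = #|M|.
Proof. by rewrite -(card_injm (injm_subg M) (subxx M)) im_subg cardsT. Qed.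

(** Union bound: a tuple that does not generate has its entries in a proper subgroup [M], and
    [2 * #|M| <= #|gT|] because the index is at least 2. *)
Lemma card_not_gens (n : nat) (gT : finGroupType) :
  (#|~: gens n gT| * 2 ^ n <= #|{group gT}| * #|gT| ^ n)%N.
Proof.
have sub : (~: gens n gT \subset
    \bigcup_(M : {group gT} | M \proper [set: gT]%SET)
      [set s : n.-tuple gT | all (mem M) s])%SET.
  apply/fintype.subsetP => s; rewrite !inE => sT; apply/bigcupP.
  exists <<[set x in s]>>%G; first by rewrite properT.
  rewrite inE; apply/allP => x xs; apply: mem_gen; by rewrite inE.
have cardM (M : {group gT}) :
    (#|[set s : n.-tuple gT | all (mem M) s]%SET| <= #|M| ^ n)%N.
  rewrite -(card_subg_of M).
  rewrite -card_tuple -cardsT.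
  pose f (t : n.-tuple (subg_of M)) := map_tuple val t.
  apply: leq_trans (leq_imset_card f _); apply: subset_leq_card.
  apply/fintype.subsetP => s; rewrite inE => /allP sM; apply/imsetP.
  exists (map_tuple (subg M) s); rewrite ?inE //; apply: val_inj => /=.
  rewrite -map_comp -[LHS]map_id; apply/eq_in_map => x xs /=.
  by rewrite subgK //; exact: sM.
apply: leq_trans (_ : \sum_(M : {group gT} | M \proper [set: gT]%SET)
    (#|M| ^ n * 2 ^ n) <= _)%N.
  rewrite -big_distrl leq_mul2r; apply/orP; right.
  apply: leq_trans (subset_leq_card sub) _.
  apply: (big_ind2 (fun (A : {set n.-tuple gT}) m => #|A| <= m)%N).
  - by rewrite cards0.
  - move=> A a B b Aa Bb; apply: leq_trans (leq_add Aa Bb).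
    by rewrite cardsU leq_subr.
  - by move=> M _; exact: cardM.
rewrite -sum_nat_const big_mkcond; apply: leq_sum => M _.
have leX e a b : (a <= b -> a ^ e <= b ^ e)%N.
  by move=> ab; case: e => // e; rewrite leq_exp2r.
case: ifP => // MT; rewrite -expnMn; apply: leX.
have := proper_sub MT; rewrite -cardsT => sMT; rewrite -(Lagrange sMT).
move: MT; rewrite leq_mul2l indexg_gt1 properE => /andP[_ ->].
by rewrite orbT.
Qed.

(** The subgroup generated by [map f s] is the image of [f], and every nonempty fibre is a coset of
    the kernel. *)
Lemma card_fiber_morph (aT rT : finGroupType) (f : aT -> rT) (s : seq aT) y :
  {morph f : x y / x * y} -> generates s ->
  y \in <<[set x in map f s]%SET>> ->
  (#|[set x | f x == y]%SET| * #|<<[set x in map f s]%SET>>| = #|aT|)%N.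
Proof.
move=> fM sT y_s.
have fM' : {in [set: aT]%SET &, {morph f : x y / x * y}}.
  by move=> ? ? _ _; exact: fM.
pose F := Morphism fM'.
have im : F @* [set: aT]%SET = <<[set x in map f s]%SET>>.
  transitivity (F @* <<[set x in s]%SET>>); first by rewrite (eqP sT).
  rewrite morphim_gen ?finset.subsetT //.
  suff -> : F @* [set x in s]%SET = [set x in map f s]%SET by [].
  rewrite morphimE finset.setTI; apply/setP => z; rewrite [RHS]inE.
  apply/imsetP/mapP.
    by move=> [x]; rewrite inE => xs ->; exists x.
  by move=> [x xs ->]; exists x; rewrite ?inE.
have [x0 _ x0y] : exists2 x, x \in [set: aT]%SET & y = f x.
  by move: y_s; rewrite -im => /morphimP[x _ _ ->]; exists x.
rewrite -im card_morphim finset.setTI -cardsT.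
rewrite -(Lagrange (finset.subsetT ('ker F))); congr (_ * _)%N.
rewrite -(card_lcoset ('ker F) x0); apply: eq_card => x.
have kF z : (z \in 'ker F) = (f z == 1) by rewrite !inE.
rewrite [LHS]inE mem_lcoset kF fM.
apply/eqP/eqP.
  by move=> ->; rewrite x0y -fM mulVg morph1_of_morph.
move=> E; apply: (mulgI (f x0^-1)); rewrite E x0y -fM mulVg.
by rewrite morph1_of_morph.
Qed.

(** The number [e] is the order of [h0] in the quotient by the subgroup generated by [h]. *)
Lemma card_gen_cons (gT : finGroupType) (h0 : gT) (h : seq gT) :
  abelian_group gT -> exists2 e : nat,
    (forall d, (h0 ^+ d \in <<[set x in h]%SET>>) = (e %| d)%N) &
    (#|<<[set x in h0 :: h]%SET>>| = e * #|<<[set x in h]%SET>>|)%N.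
Proof.
move=> gT_ab; set K := <<[set x in h]%SET>>%G.
have inN u : u \in 'N(K).
  have CC : u \in 'C(K) by apply/centP => v _; exact: abelian_mulgC.
  exact: (fintype.subsetP (cent_sub K) _ CC).
have subN (A : {set gT}) : A \subset 'N(K) by apply/fintype.subsetP.
exists #[coset K h0] => [d|].
  rewrite order_dvdn -morphX //; apply/idP/eqP => [|/coset_idr]; last exact.
  exact: coset_id.
have -> : <<[set x in h0 :: h]%SET>> = <[h0]> <*> K.
  rewrite /= joing_idr joing_idl; apply: (congr1 (@generated _)).
  by apply/setP => x; rewrite !inE.
rewrite /order -quotient_cycle // -(quotientYidr (subN <[h0]>)).
rewrite card_quotient // mulnC; apply/esym/Lagrange.
exact: joing_subr.
Qed.

(** By [card_sur_gens] both sides count generating tuples satisfying given relations, and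
    isomorphisms preserve generation and kernels. The tuple of all elements of [gT] serves as
    [s]. *)
Lemma card_sur_iso (gT gT' rT rT' : finGroupType) :
  isomorphic gT gT' -> isomorphic rT rT' -> card_sur gT rT = card_sur gT' rT'.
Proof.
move=> /isomorphicP[f fM fb] /isomorphicP[g gM gb].
have [n [s sT]] : exists n, exists s : n.-tuple gT, s \in gens n gT.
  exists #|gT|, (enum_tuple gT); rewrite inE; apply/eqP.
  apply/setP => x; rewrite [RHS]inE; apply: mem_gen.
  by rewrite inE mem_enum.
have sT' : map_tuple f s \in gens n gT'.
  by move: sT; rewrite !inE => sT; exact: generates_bij.
rewrite -(card_sur_gens rT sT) -(card_sur_gens rT' sT') /=.
have g_inj : injective (fun t : n.-tuple rT => map_tuple g t).
  move=> t u /(congr1 val) /= /(inj_map (bij_inj gb)); exact: val_inj.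
rewrite -(card_imset _ g_inj); apply: eq_card => t; rewrite inE.
apply/imsetP/andP => [[u]|[tT /asboolP st]].
  rewrite !inE => /andP[uT /asboolP su] ->.
  split=> /=; first exact: generates_bij.
  by rewrite !wker_map_inj //; exact: bij_inj.
case: (gb) => g' gK g'K.
have g'M : {morph g' : x y / x * y}.
  by move=> x y; apply: (bij_inj gb); rewrite gM !g'K.
exists (map_tuple g' t); last first.
  by apply: val_inj; rewrite /= -map_comp -[LHS]map_id; apply: eq_map => x /=.
have g'b : bijective g' by exists g.
rewrite !inE; move: tT; rewrite inE => tT; apply/andP; split=> /=.
  exact: generates_bij.
apply/asboolP; rewrite wker_map_inj //; last exact: bij_inj.
by move: st; rewrite /= wker_map_inj //; exact: bij_inj.
Qed.

Lemma card_aut_iso (gT gT' : finGroupType) :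
  isomorphic gT gT' -> card_aut gT = card_aut gT'.
Proof.
move=> /isomorphicP[f fM fb].
have f_in : {in [set: gT]%SET &, {morph f : x y / x * y}} by move=> ? ? _ _.
have f_injm : 'injm (Morphism f_in).
  by apply/injmP => x y _ _; exact: bij_inj.
have im : Morphism f_in @* [set: gT]%SET = [set: gT']%SET.
  apply/setP => y; rewrite [RHS]inE; case: fb => g fK gK; rewrite -(gK y).
  by apply: (mem_morphim (Morphism f_in)); rewrite inE.
rewrite /card_aut -im; apply/esym/card_isog.
exact: (injm_Aut f_injm (subxx _)).
Qed.


End GeneratingTuples.

(** * Sums over marked groups *)

Section Sums.
Import Order.TTheory GRing.Theory Num.Theory.
Local Open Scope ereal_scope.
Variable R : realType.

Lemma esum_fiber (T T' : choiceType) (X : set T) (C : set T') (f : T -> T')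
    (a : T -> \bar R) :
  (forall x, X x -> C (f x)) -> (forall x, X x -> 0 <= a x) ->
  \esum_(x in X) a x = \esum_(c in C) \esum_(x in X `&` f @^-1` [set c]) a x.
Proof.
move=> XC a0; rewrite (esum_esum (a := fun _ x => a x)) => [|c x _ [/a0]] //.
rewrite (@reindex_esum R _ _ X _ (fun x => (f x, x))) //.
split=> [x Xx /=|x y _ _ [_ ->] //|[c x] /= [_ [Xx <-]]].
  by split; [exact: XC|].
by exists x.
Qed.

Lemma esum_exchange (T T' : choiceType) (X : set T) (Y : set T')
    (a : T -> T' -> \bar R) :
  (forall x y, X x -> Y y -> 0 <= a x y) ->
  \esum_(x in X) \esum_(y in Y) a x y = \esum_(y in Y) \esum_(x in X) a x y.
Proof.
move=> a0; rewrite !esum_esum //; last by move=> y x Yy Xx; exact: a0.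
rewrite (@reindex_esum R _ _ (Y `*` X) _ (fun u => (u.2, u.1))) //.
split=> [[y x] [] //|[y x] [y' x'] _ _ [-> ->] //|[x y] [Xx Yy]].
by exists (y, x).
Qed.

Lemma esum_single (T : choiceType) (X : set T) (x0 : T) (a : T -> \bar R) :
  X x0 -> 0 <= a x0 -> (forall x, X x -> x != x0 -> a x = 0) ->
  \esum_(x in X) a x = a x0.
Proof.
move=> X0 a0 aN.
have a_ge0 x : X x -> 0 <= a x.
  by move=> Xx; have [->//|xN] := eqVneq x x0; rewrite aN.
rewrite (esumID [set x0]) // [X in _ + X]esum1 => [|x [Xx /eqP]]; last first.
  exact: aN.
by rewrite adde0 setIidr ?esum_set1 // => x ->.
Qed.

Lemma esum_fin (T : finType) (A : {pred T}) (a : T -> \bar R) :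
  (forall x, x \in A -> 0 <= a x) ->
  \esum_(x in [set x | x \in A]) a x = \sum_(x in A) a x.
Proof.
move=> a0; have -> : [set x | x \in A] = [set` enum A].
  by apply/seteqP; split=> x /=; rewrite mem_enum.
rewrite esum_fset //; last by move=> x; rewrite inE /= mem_enum => /a0.
by rewrite -fsbig_seq ?enum_uniq // big_enum.
Qed.

Lemma esum_const (T : finType) (A : {pred T}) (c : R) : (0 <= c)%R ->
  \esum_(x in [set x | x \in A]) c%:E = (#|A|%:R * c)%:E.
Proof.
move=> c0; rewrite esum_fin => [|x _]; last by rewrite lee_fin.
by rewrite sumEFin sumr_const mulr_natl.
Qed.

Lemma esum_le (T : choiceType) (X : set T) (a : T -> \bar R) (c : \bar R) :
  (forall Y : {fset T}, [set` Y] `<=` X -> \sum_(x <- Y) a x <= c) ->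
  \esum_(x in X) a x <= c.
Proof.
move=> Yc; apply: ge_ereal_sup => _ [Y [Yfin YX] <-].
by rewrite fsbig_finite //; apply: Yc; rewrite fset_setK.
Qed.

Lemma esum_ge_fset (T : choiceType) (X : set T) (a : T -> \bar R)
    (Y : {fset T}) :
  [set` Y] `<=` X -> \sum_(x <- Y) a x <= \esum_(x in X) a x.
Proof.
move=> YX; apply: esum_ge; exists [set` Y]; first by split.
by rewrite -fsbig_seq.
Qed.

(** One inequality is tested on finite subsums; the other is the same inequality for [c^-1]. *)
Lemma esumZl (T : choiceType) (X : set T) (a : T -> \bar R) (c : R) :
  (0 < c)%R -> (forall x, X x -> 0 <= a x) ->
  \esum_(x in X) (c%:E * a x) = c%:E * \esum_(x in X) a x.
Proof.
have half (b : T -> \bar R) (e : R) : (0 < e)%R ->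
    (forall x, X x -> 0 <= b x) ->
    \esum_(x in X) (e%:E * b x) <= e%:E * \esum_(x in X) b x.
  move=> e0 b0; apply: esum_le => Y YX; rewrite big_seq -ge0_sume_distrr.
    rewrite -big_seq lee_pmul2l ?fin_numE // ?lte_fin //.
    exact: esum_ge_fset.
  by move=> x xY; apply/b0/YX.
move=> c0 a0; apply/eqP; rewrite eq_le half //=.
have -> : \esum_(x in X) a x = \esum_(x in X) (c^-1%:E * (c%:E * a x)).
  by apply: eq_esum => x _; rewrite muleA -EFinM mulVf ?gt_eqF // mul1e.
apply: le_trans (_ : c%:E * (c^-1%:E * \esum_(x in X) (c%:E * a x)) <= _).
  rewrite lee_pmul2l ?lte_fin ?fin_numE // half ?invr_gt0 //.
  by move=> x Xx; apply: mule_ge0; [rewrite lee_fin ltW|exact: a0].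
by rewrite muleA -EFinM divff ?gt_eqF // mul1e.
Qed.

Lemma esumZr (T : choiceType) (X : set T) (a : T -> \bar R) (c : R) :
  (0 < c)%R -> (forall x, X x -> 0 <= a x) ->
  \esum_(x in X) (a x * c%:E) = (\esum_(x in X) a x) * c%:E.
Proof.
move=> c0 a0; rewrite muleC -esumZl //.
by apply: eq_esum => x _; rewrite muleC.
Qed.

End Sums.

(** * Representatives of isomorphism types, and marked groups *)

Section MarkedGroups.
Import Order.TTheory GRing.Theory Num.Theory.

HB.instance Definition _ := gen_eqMixin finAbGroup.
HB.instance Definition _ := gen_choiceMixin finAbGroup.

(** The element is picked in the whole isomorphism class, hence depends on the class only; the fixed
    points of [rep] then index the isomorphism types. *)
Definition rep (G : finAbGroup) : finAbGroup :=
  xget trivial_group [set H : finAbGroup | isomorphic G H].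

Lemma rep_iso (G : finAbGroup) : isomorphic G (rep G).
Proof.
by apply: (@xgetPex _ trivial_group [set H : finAbGroup | isomorphic G H]);
  exists G; exact: isomorphic_refl.
Qed.

Lemma rep_eq (G H : finAbGroup) : isomorphic G H -> rep G = rep H.
Proof.
move=> GH; congr xget; apply/seteqP; split=> K /= ?.
  exact: isomorphic_trans (isomorphic_sym GH) _.
exact: isomorphic_trans GH _.
Qed.

Lemma pi_group_iso P (gT rT : finGroupType) :
  isomorphic gT rT -> pi_group P gT = pi_group P rT.
Proof. by move=> gr; rewrite /pi_group /pgroup (card_isog gr). Qed.

Definition reps (P : {fset nat}) : set finAbGroup :=
  [set G | rep G = G /\ pi_group P G].

Lemma reps_rep P (G : finAbGroup) : pi_group P G -> reps P (rep G).
Proof.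
move=> GP; split; last by rewrite -(pi_group_iso _ (rep_iso G)).
by apply/esym/rep_eq/rep_iso.
Qed.

Lemma card_iso (gT rT : finGroupType) : isomorphic gT rT -> #|gT| = #|rT|.
Proof. by move=> /isomorphicP[f _ fb]; exact: bij_eq_card fb. Qed.

(* A marked group is represented by the kernel of the evaluation of words. *)
Definition marked (P : {fset nat}) (n : nat) : set (set (seq nat * seq nat)) :=
  [set K | exists (G : finAbGroup) (s : seq G),
    [/\ size s = n, generates s, pi_group P G & wker s = K]].

(** By [wker_iso] the kernel determines the order. The default 0 is taken on sets that are not the
    kernel of [n] generators of a finite abelian group. *)
Definition marked_order (n : nat) (K : set (seq nat * seq nat)) : nat :=
  xget 0%N [set m | exists (G : finAbGroup) (s : seq G),
    [/\ size s = n, generates s, wker s = K & #|G| = m]].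

Lemma marked_orderE (gT : finGroupType) (s : seq gT) :
  abelian_group gT -> generates s ->
  marked_order (size s) (wker s) = #|gT|.
Proof.
move=> gT_ab sT; have /isomorphicP[f fM fb] := small_modelP gT_ab.
rewrite /marked_order; case: xgetP => [m _ [G [t [st tT kst <-]]]|/(_ #|gT|)].
  have [g [_ gb _]] := wker_iso tT sT st kst.
  exact: bij_eq_card gb.
case; exists (small_model gT_ab), (map f s); split.
- by rewrite size_map.
- exact: generates_bij.
- by apply: wker_map_inj => //; exact: bij_inj.
by apply/esym/card_iso; exact: small_modelP.
Qed.

Lemma marked_wker P (gT : finGroupType) (s : seq gT) :
  abelian_group gT -> pi_group P gT -> generates s ->
  marked P (size s) (wker s).
Proof.
move=> gT_ab gT_pi sT; have /isomorphicP[f fM fb] := small_modelP gT_ab.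
exists (small_model gT_ab), (map f s); split.
- by rewrite size_map.
- exact: generates_bij.
- by rewrite -(pi_group_iso _ (small_modelP gT_ab)).
by apply: wker_map_inj => //; exact: bij_inj.
Qed.

Lemma card_aut_gt0 (gT : finGroupType) : (0 < card_aut gT)%N.
Proof. exact: cardG_gt0. Qed.

(** The generating tuples of [gT] are sorted by their kernels. *)
Lemma esum_gens_wker (R : realType) P n (L : set (seq nat * seq nat))
    (gT : finGroupType) (c : R) :
  abelian_group gT -> pi_group P gT -> 0 <= c ->
  (\esum_(K in marked P n `&` [set K | K `<=` L])
    (#|[set s in gens n gT | `[< wker s = K >]]%SET|%:R * c)%:E =
  (#|[set s in gens n gT | `[< wker s `<=` L >]]%SET|%:R * c)%:E)%E.
Proof.
move=> gT_ab gT_pi c0; rewrite -[RHS]esum_const //.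
rewrite (esum_fiber (C := marked P n `&` [set K | K `<=` L])
  (f := fun s => wker (val s))); last 2 first.
- move=> s /=; rewrite !inE => /andP[sT /asboolP sL]; split=> //.
  by have := marked_wker gT_ab gT_pi sT; rewrite size_tuple.
- by move=> s _; rewrite lee_fin.
apply: eq_esum => K [_ KL]; rewrite -esum_const //.
congr (esum _ _); apply/seteqP; split=> s /=; rewrite !inE.
  by move=> /andP[-> /asboolP sK]; split=> //; rewrite sK; apply/asboolP.
by move=> [/andP[-> _] <-]; apply/asboolP.
Qed.

(** Exchange of sums. A marked kernel [K] occurs in a single representative group, and there
    [card_aut] generating tuples have kernel [K], which cancels the weight [1 / card_aut]. *)
Lemma esum_marked (R : realType) P n (L : set (seq nat * seq nat))
    (f : nat -> R) : (forall m, 0 <= f m) ->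
  (\esum_(G in reps P)
    (#|[set s in gens n G | `[< wker s `<=` L >]]%SET|%:R *
      (f #|G| / (card_aut G)%:R))%:E =
   \esum_(K in marked P n `&` [set K | K `<=` L]) (f (marked_order n K))%:E)%E.
Proof.
move=> f0; have c0 (G : finAbGroup) : 0 <= f #|G| / (card_aut G)%:R.
  by rewrite divr_ge0.
transitivity (\esum_(G in reps P)
    \esum_(K in marked P n `&` [set K | K `<=` L])
      (#|[set s in gens n G | `[< wker s = K >]]%SET|%:R *
        (f #|G| / (card_aut G)%:R))%:E)%E.
  apply: eq_esum => G [_ GP]; apply/esym/esum_gens_wker => //.
  exact: finab_abelian.
rewrite esum_exchange => [|G K _ _]; last by rewrite lee_fin mulr_ge0.
apply: eq_esum => K [[G [s [sn sT GP sK]]] _].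
have /isomorphicP[g gM gb] := rep_iso G.
have ts : size (map g s) == n by rewrite size_map sn.
pose t : n.-tuple (rep G) := Tuple ts.
have tE : tval t = map g s by [].
have tT : t \in gens n (rep G) by rewrite inE tE; exact: generates_bij.
have tK : wker t = K by rewrite tE wker_map_inj //; exact: bij_inj.
rewrite (esum_single (x0 := rep G)).
- have := card_gens_wker tT; rewrite tK => ->; congr _%:E.
  rewrite mulrC divfK ?pnatr_eq0 -?lt0n ?card_aut_gt0 //.
  have tT' : generates t by rewrite tE; exact: generates_bij.
  have := marked_orderE (finab_abelian (rep G)) tT'.
  by rewrite size_tuple tK => ->.
- exact: reps_rep.
- by rewrite lee_fin mulr_ge0.
move=> H [Hrep HP] HG; rewrite (_ : #|_| = 0%N) ?mul0r //.
apply: eq_card0 => u; rewrite !inE; apply/negP => /andP[uT /asboolP uK].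
move: HG => /eqP; apply; rewrite -Hrep; apply: rep_eq.
have [h [hM hb _]] : exists h : H -> G,
    [/\ {morph h : x y / (x * y)%g}, bijective h & map h u = s].
  by apply: wker_iso; rewrite ?size_tuple ?uK.
by apply/isomorphicP; exists h.
Qed.

End MarkedGroups.

(** * The marked groups with a given tail *)

Section Recursion.
Import GroupScope.

Definition smooth (P : {fset nat}) : pred nat :=
  fun d => [pred p : nat | p \in P].-nat d.

Lemma pi_groupE P (gT : finGroupType) : pi_group P gT = smooth P #|gT|.
Proof. by rewrite /pi_group /pgroup cardsT. Qed.

Lemma smooth_gt0 P d : smooth P d -> (0 < d)%N.
Proof. by rewrite /smooth => /andP[]. Qed.

Lemma smoothM P d e : smooth P (d * e)%N = smooth P d && smooth P e.
Proof. exact: pnatM. Qed.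

(** Restriction to the words without the letter 0: on kernels, this forgets the first generator and
    renumbers the others. *)
Definition shift (K : set (seq nat * seq nat)) : set (seq nat * seq nat) :=
  [set vw | K (map succn vw.1, map succn vw.2)]%classic.

Lemma wordval_succ (gT : finGroupType) (g : gT) s w :
  wordval (g :: s) (map succn w) = wordval s w.
Proof. by rewrite /wordval big_map. Qed.

Lemma wordval_nseq (gT : finGroupType) (g : gT) s a :
  wordval (g :: s) (nseq a 0%N) = g ^+ a.
Proof.
elim: a => [|a IHa]; first by rewrite wordval_nil expg0.
by rewrite [nseq _ _]/= wordval_cons IHa expgS.
Qed.

Lemma shift_wker (gT : finGroupType) (g : gT) s :
  shift (wker (g :: s)) = wker s.
Proof.
by apply/seteqP; split=> -[v w]; rewrite /shift /wker /= !wordval_succ.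
Qed.

Definition extker_set (aT : finGroupType) (s : seq aT) (u : nat * aT) :
  set (seq nat * seq nat) := [set vw | extker s u.1 u.2 vw.1 vw.2]%classic.

Section Fiber.
Variables (P : {fset nat}) (aT : finGroupType) (s : seq aT).
Hypotheses (aT_ab : abelian_group aT) (aT_pi : pi_group P aT).
Hypothesis sT : generates s.

Lemma extker_power d w : (0 < d)%N ->
  extker s d (wordval s w) (nseq d 0%N) (map succn w).
Proof.
move=> d0; rewrite /extker wtail_succ count_mem_succ wtail_nseq count_mem_nseq0.
by rewrite modnn mod0n div0n divnn d0 expg0 expg1 mul1g wordval_nil mulg1.
Qed.

(** The relation [g ^+ d = x], written with a word for [x], is tested in the other kernel: it forces
    [d'] to divide [d], and [x = x'] once [d = d']. *)
Lemma extker_set_inj d x d' x' : (0 < d)%N -> (0 < d')%N ->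
  extker_set s (d, x) = extker_set s (d', x') -> (d, x) = (d', x').
Proof.
have half e y e' y' : (0 < e)%N -> (0 < e')%N ->
    extker_set s (e, y) = extker_set s (e', y') ->
    (e' %| e)%N /\ (e = e' -> y = y').
  move=> e0 e'0 E; have [w wy] := generatesP _ sT y.
  have : extker_set s (e, y) (nseq e 0%N, map succn w).
    by rewrite /extker_set /= -wy; exact: extker_power.
  rewrite E /extker_set /extker /= wtail_succ count_mem_succ wtail_nseq.
  rewrite count_mem_nseq0 mod0n div0n expg0 mul1g wordval_nil mulg1 wy.
  move=> [/eqP e'e ye]; split=> // ee'.
  by rewrite -ye ee' divnn e'0 expg1.
move=> d0 d'0 E; have [d'd xx'] := half _ _ _ _ d0 d'0 E.
have [dd' _] := half _ _ _ _ d'0 d0 (esym E).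
have dE : d = d' by apply/eqP; rewrite eqn_dvd dd' d'd.
by rewrite -(xx' dE) dE.
Qed.

(** Each pair [(d, x)] is realised by the extension from [cyclic_ext_exists]. *)
Lemma extker_set_marked d x : smooth P d ->
  [/\ marked P (size s).+1 (extker_set s (d, x)),
      shift (extker_set s (d, x)) = wker s &
      marked_order (size s).+1 (extker_set s (d, x)) = (d * #|aT|)%N].
Proof.
move=> dP; have d0 := smooth_gt0 dP.
have [gT [i [g [gT_ab iM i_inj ext span]]]] := cyclic_ext_exists x aT_ab d0.
have kE : extker_set s (d, x) = wker (g :: map i s).
  apply/seteqP; split=> -[v w]; rewrite /extker_set /wker /=.
    by move/(cyclic_ext_ker gT_ab iM i_inj ext).
  by move/(cyclic_ext_ker gT_ab iM i_inj ext).
have gsT := cyclic_ext_generates gT_ab iM sT span.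
have gT_card := cyclic_ext_card iM i_inj ext span.
have sz : size (g :: map i s) = (size s).+1 by rewrite /= size_map.
have gT_pi : pi_group P gT by rewrite pi_groupE gT_card smoothM dP -pi_groupE.
rewrite kE -sz; split.
- exact: marked_wker.
- by rewrite shift_wker wker_map_inj.
by rewrite marked_orderE.
Qed.

(** Equality of kernels embeds [aT] as the subgroup generated by the tail [t], and [(d, x)] is then
    the invariant of the first generator [g]. *)
Lemma marked_extker_set K : marked P (size s).+1 K -> shift K = wker s ->
  exists2 u : nat * aT, smooth P u.1 & K = extker_set s u.
Proof.
move=> [G [[|g t] [//= [st] gtT GP <-]]]; rewrite shift_wker => kst.
have [i iM it] : exists2 i : aT -> G, {morph i : x y / x * y} & map i s = t.
  by apply: wker_morph => //; rewrite kst.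
have i_inj : injective i.
  move=> x y; have [v <-] := generatesP _ sT x.
  have [w <-] := generatesP _ sT y.
  rewrite -!wordval_map // it => vw.
  have : wker t (v, w) by exact: vw.
  by rewrite kst.
have [d [x ext]] := cyclic_ext_type g iM i_inj.
have G_ab : abelian_group G by exact: finab_abelian.
have span : forall u, exists a y, u = g ^+ a * i y.
  by apply: (cyclic_ext_span G_ab iM (s := s)); rewrite it.
exists (d, x).
  have E := cyclic_ext_card iM i_inj ext span.
  by move: GP; rewrite pi_groupE E smoothM => /andP[].
rewrite -it; apply/seteqP; split=> -[v w]; rewrite /extker_set /wker /=.
  by move/(cyclic_ext_ker G_ab iM i_inj ext).
by move/(cyclic_ext_ker G_ab iM i_inj ext).
Qed.

(** Universal property of the extension: [f] extends by sending the new generator to [h0] exactly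
    when the one new relation is respected. *)
Lemma extker_set_sub (hT : finGroupType) (f : aT -> hT) h0 d x :
  abelian_group hT -> {morph f : y z / y * z} -> (0 < d)%N ->
  (extker_set s (d, x) `<=` wker (h0 :: map f s))%classic <-> f x = h0 ^+ d.
Proof.
move=> hT_ab fM d0; split=> [sub|fx [v w]].
  have [w wx] := generatesP _ sT x.
  have /sub : extker_set s (d, x) (nseq d 0%N, map succn w).
    by rewrite /extker_set /= -wx; exact: extker_power.
  by rewrite /wker /= wordval_nseq wordval_succ wordval_map // wx.
rewrite /extker_set /extker /wker /= => -[vw E].
have nf a y : h0 ^+ a * f y = h0 ^+ (a %% d) * f (x ^+ (a %/ d) * y).
  rewrite {1}(divn_eq a d) addnC expgD mulnC expgM -fx.
  by rewrite fM (morphX_of_morph _ _ fM) mulgA.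
by rewrite !wordval_wtail // !wordval_map // nf vw E -nf.
Qed.

End Fiber.
End Recursion.

(** * Summation over marked groups, one generator at a time *)

Section MarkedSum.
Import Order.TTheory GRing.Theory Num.Theory.
Variables (R : realType) (P : {fset nat}).

Lemma extker_set_bij (aT hT : finGroupType) (s : seq aT) (f : aT -> hT) h0 :
  abelian_group aT -> pi_group P aT -> generates s ->
  abelian_group hT -> {morph f : y z / (y * z)%g} ->
  set_bij [set u : nat * aT | smooth P u.1 /\ f u.2 = (h0 ^+ u.1)%g]
    [set K | [/\ marked P (size s).+1 K, K `<=` wker (h0 :: map f s) &
      shift K = wker s]] (extker_set s).
Proof.
move=> aT_ab aT_pi sT hT_ab fM; split.
- move=> [d x] /= [dP fx].
  have [mK shK _] := extker_set_marked aT_ab aT_pi sT x dP.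
  split=> //; apply/extker_set_sub => //; exact: smooth_gt0 dP.
- move=> [d x] [d' x']; rewrite !inE /= => -[dP _] [d'P _].
  by apply: extker_set_inj => //; [exact: smooth_gt0 dP|exact: smooth_gt0 d'P].
move=> K /= [mK Kh Ks]; have [[d x] /= dP KE] := marked_extker_set sT mK Ks.
exists (d, x) => //=; split=> //.
by apply/(extker_set_sub sT) => //; [exact: smooth_gt0 dP|rewrite -KE].
Qed.

(** The Riemann zeta function reduced to its Euler factors at the primes in [P]. *)
Definition zetaP (j : nat) : \bar R :=
  (\esum_(d in [set d | smooth P d]) (d%:R ^- j)%:E)%E.

(** The sum runs over the pairs [(d, x)] with [f x = h0 ^+ d]. Such [x] exist only if [e] divides
    [d], and they then form a coset of the kernel of [f], of size [#|aT|] divided by the order of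
    the image. Writing [d] as [e] times a smooth number leaves [zetaP j]. *)
Lemma esum_marked_fiber (aT hT : finGroupType) (s : seq aT) (f : aT -> hT)
    h0 e j z :
  abelian_group aT -> pi_group P aT -> generates s ->
  abelian_group hT -> {morph f : y z / (y * z)%g} ->
  (forall d, (h0 ^+ d \in <<[set x in map f s]%SET>>)%g = (e %| d)%N) ->
  smooth P e -> zetaP j = z%:E ->
  (\esum_(K in [set K | [/\ marked P (size s).+1 K,
      K `<=` wker (h0 :: map f s) & shift K = wker s]])
    ((marked_order (size s).+1 K)%:R ^- j)%:E =
  ((#|aT|%:R / #|aT|%:R ^+ j) *
    (#|<<[set x in map f s]%SET>>%g|%:R^-1 * e%:R ^- j * z))%:E)%E.
Proof.
move=> aT_ab aT_pi sT hT_ab fM eP e_smooth zE.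
rewrite (reindex_esum _ _ _ _ (extker_set_bij h0 aT_ab aT_pi sT hT_ab fM)).
have -> : [set u : nat * aT | smooth P u.1 /\ f u.2 = (h0 ^+ u.1)%g] =
    [set d | smooth P d] `*``
      (fun d => [set x | x \in [set x | f x == (h0 ^+ d)%g]%SET]).
  by apply/seteqP; split=> -[d x] /= [dP]; rewrite inE => /eqP.
transitivity (\esum_(u in [set d | smooth P d] `*``
    (fun d => [set x | x \in [set x | f x == (h0 ^+ d)%g]%SET]))
      ((u.1 * #|aT|)%:R ^- j : R)%:E)%E.
  apply: eq_esum => -[d x] [dP _].
  by have [_ _ ->] := extker_set_marked aT_ab aT_pi sT x dP.
rewrite -(esum_esum (a := fun d _ => ((d * #|aT|)%:R ^- j : R)%:E)); last first.
  by move=> d x _ _; rewrite lee_fin invr_ge0 exprn_ge0.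
set C := #|<<[set x in map f s]%SET>>%g|.
have C0 : (0 < C)%N by exact: cardG_gt0.
have e0 := smooth_gt0 e_smooth.
have A0 : (0 < #|aT|)%N by rewrite -cardsT; exact: cardG_gt0.
have fib d : #|[set x | f x == (h0 ^+ d)%g]%SET|%:R =
    if (e %| d)%N then #|aT|%:R / C%:R else 0 :> R.
  case: ifPn => ed.
    rewrite -(card_fiber_morph fM sT (y := (h0 ^+ d)%g)) ?eP // natrM.
    by rewrite mulfK // pnatr_eq0 -lt0n.
  rewrite (_ : #|_| = 0%N) //; apply: eq_card0 => x; rewrite !inE.
  apply: contraNF ed => /eqP fx; rewrite -eP -fx; apply/mem_gen_wordval.
  have [w <-] := generatesP _ sT x; exists w.
  by rewrite wordval_map.
transitivity (\esum_(d in [set d | smooth P d] `&` [set d | (e %| d)%N])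
    (#|aT|%:R / C%:R * (d * #|aT|)%:R ^- j : R)%:E)%E.
  rewrite esum_mkcondr; apply: eq_esum => d _.
  rewrite esum_const ?invr_ge0 ?exprn_ge0 // fib.
  have -> : (d \in [set d | (e %| d)%N]) = (e %| d)%N.
    by apply/idP/idP; rewrite inE.
  by case: ifP; rewrite // mul0r.
have eb : set_bij [set d | smooth P d]
    ([set d | smooth P d] `&` [set d | (e %| d)%N]) (muln e).
  split=> [d /= dP|d d' _ _ /eqP|d /= [dP /dvdnP[d' dE]]].
  - by rewrite smoothM e_smooth dP dvdn_mulr.
  - by rewrite eqn_pmul2l // => /eqP.
  exists d'; rewrite /= ?(mulnC e) //.
  by move: dP; rewrite dE smoothM => /andP[].
rewrite (reindex_esum _ _ _ _ eb).
transitivity (\esum_(d in [set d | smooth P d])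
    ((#|aT|%:R / #|aT|%:R ^+ j * (C%:R^-1 * e%:R ^- j) : R)%:E *
      (d%:R ^- j)%:E))%E.
  apply: eq_esum => d _; rewrite -EFinM; congr _%:E.
  rewrite !natrM !exprMn !invfM.
  move: (#|aT|%:R) (#|aT|%:R ^- j) (C%:R^-1) (e%:R ^- j) (d%:R ^- j).
  by move=> a a' c' e' d'; lra.
rewrite esumZl; last 2 first.
- by rewrite !mulr_gt0 ?invr_gt0 ?exprn_gt0 ?ltr0n.
- by move=> d _; rewrite lee_fin invr_ge0 exprn_ge0.
by rewrite -/(zetaP j) zE -EFinM !mulrA.
Qed.

Lemma smooth_dvd e d : (e %| d)%N -> smooth P d -> smooth P e.
Proof. exact: pnat_dvd. Qed.

(** The sequence [s] generates, with the same relations, the subgroup it spans, seen as a group of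
    its own. *)
Lemma marked_wker_sub (gT : finGroupType) (s : seq gT) :
  abelian_group gT -> pi_group P gT -> marked P (size s) (wker s).
Proof.
move=> gT_ab gT_pi; set M := <<[set x in s]%SET>>%G.
pose t := map (subg M) s.
have valM : {morph (val : subg_of M -> gT) : x y / (x * y)%g} by [].
have tE : map val t = s.
  rewrite -map_comp -[RHS]map_id; apply/eq_in_map => x xs /=.
  by rewrite subgK // mem_gen // inE.
have tT : generates t.
  apply/generatesP => x; have /mem_gen_wordval[w wx] := valP x.
  by exists w; apply: val_inj; rewrite -(wordval_map t w valM) tE.
have -> : wker s = wker t by rewrite -tE wker_map_inj //; exact: val_inj.
have -> : size s = size t by rewrite size_map.
apply: marked_wker => //.
  apply/centsP => x _ y _; apply: val_inj; exact: abelian_mulgC.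
rewrite pi_groupE card_subg_of; apply: smooth_dvd (_ : smooth P #|gT|).
  by rewrite -cardsT cardSg ?finset.subsetT.
by rewrite -pi_groupE.
Qed.

(** Induction on [h], the kernels being sorted by [shift]. In the fibre over a marked group [G] the
    choices of [x] give a factor [#|G|], which lowers the exponent of [#|G|] by one, to that of the
    shorter tuple. *)
Lemma marked_sum (hT : finGroupType) (h : seq hT) (z : nat -> R) :
  abelian_group hT -> pi_group P hT ->
  (forall j, (0 < j)%N -> zetaP j = (z j)%:E) ->
  (\esum_(K in marked P (size h) `&` [set K | K `<=` wker h])
    ((marked_order (size h) K)%:R ^- size h)%:E =
  (#|<<[set x in h]%SET>>%g|%:R ^- size h *
    \prod_(1 <= j < (size h).+1) z j)%:E)%E.
Proof.
move=> hT_ab hT_pi zE; elim: h => [|h0 h IHh].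
  rewrite /= big_geq // mulr1 !expr0 invr1.
  have triv_gen : @generates trivial_group [::].
    by apply/generatesP => x; exists [::]; rewrite wordval_nil [x]trivial_setT.
  have G_pi : pi_group P trivial_group by exact: (@trivial_pi 1 P ord0 erefl).
  (* Without generators every word has value 1, so the full set of pairs is the only kernel. *)
  have KT (G : finGroupType) (s : seq G) : size s = 0%N -> wker s = setT.
    case: s => // _; apply/seteqP; split=> // -[v w] _.
    have w1 (u : seq nat) : wordval [::] u = 1%g :> G.
      by rewrite /wordval big1 // => i _; rewrite nth_nil.
    by rewrite /wker /= !w1.
  rewrite (esum_single (x0 := setT)) ?expr0 ?invr1 ?lee_fin //.
    split; last by rewrite /= KT.
    by exists trivial_group, [::]; rewrite KT.
  by move=> K [[G [s [s0 _ _ <-]]] _]; rewrite KT ?eqxx.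
have [e eP cE] := card_gen_cons h0 h hT_ab.
have e_smooth : smooth P e.
  apply: (@smooth_dvd _ #|hT|); last by rewrite -pi_groupE.
  apply: dvdn_trans (_ : #|<<[set x in h0 :: h]%SET>>%g| %| _)%N.
    by rewrite cE dvdn_mulr.
  by rewrite -cardsT cardSg ?finset.subsetT.
rewrite (esum_fiber (C := marked P (size h) `&` [set K | K `<=` wker h])
  (f := shift)); last 2 first.
- move=> K [[G [[|g s] [//= [sn] gsT GP KE]]] /= Kh]; split.
    rewrite -KE shift_wker -sn.
    exact: (@marked_wker_sub G s (finab_abelian G) GP).
  by move=> [v w] /Kh; rewrite /wker /= !wordval_succ.
- by move=> K _; rewrite lee_fin invr_ge0 exprn_ge0.
(* The term [d = 1] already gives a zeta value of at least 1; positivity lets the constant [c] be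
   taken out of the sum. *)
have z0 : 0 < z (size h).+1.
  rewrite -lte_fin -zE //; apply: (@lt_le_trans _ _ 1%E) => //.
  apply: esum_ge; exists [set 1%N].
    by split; [exact: finite_set1|move=> d /= ->; rewrite /smooth].
  by rewrite fsbig_set1 expr1n invr1.
set c := #|<<[set x in h]%SET>>%g|%:R^-1 * e%:R ^- (size h).+1 * z (size h).+1.
have e0 := smooth_gt0 e_smooth.
have C0 : (0 < #|<<[set x in h]%SET>>%g|)%N by exact: cardG_gt0.
transitivity (\esum_(K in marked P (size h) `&` [set K | K `<=` wker h])
    (c%:E * ((marked_order (size h) K)%:R ^- size h)%:E))%E.
  apply: eq_esum => K [[G [s [sn sT GP KE]]] /= Kh].
  have [f fM fs] : exists2 f : G -> hT,
      {morph f : x y / (x * y)%g} & map f s = h.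
    by apply: wker_morph => //; rewrite KE.
  have G_ab : abelian_group G by exact: finab_abelian.
  rewrite -sn -KE marked_orderE //.
  have := @esum_marked_fiber G hT s f h0 e (size s).+1 (z (size s).+1)
    G_ab GP sT hT_ab fM.
  rewrite fs => /(_ eP e_smooth (zE (size s).+1 isT)) IS.
  transitivity ((#|G|%:R / #|G|%:R ^+ (size s).+1 * c)%:E)%E; last first.
    rewrite -EFinM; congr _%:E; rewrite mulrC; congr (_ * _).
    have G0 : #|G|%:R != 0 :> R by rewrite pnatr_eq0 -lt0n -cardsT cardG_gt0.
    by rewrite exprS invfM mulrA divff // mul1r.
  rewrite /c -sn -IS; congr (esum _ _); apply/seteqP; split=> L /=.
    by move=> [[]].
  by move=> [].
rewrite esumZl //; last by rewrite /c !mulr_gt0 ?invr_gt0 ?exprn_gt0 ?ltr0n.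
rewrite IHh -EFinM cE [size (h0 :: h)]/= [X in _ = (_ * X)%:E]big_nat_recr //=.
rewrite /c; set C := #|_|; congr _%:E.
have -> : (e * C)%:R ^- (size h).+1 =
    C%:R^-1 * C%:R ^- size h * e%:R ^- (size h).+1 :> R.
  by rewrite natrM exprMn invfM [C%:R ^+ _.+1]exprS invfM mulrC.
move: (e%:R ^- _) (C%:R^-1) (C%:R ^- _) (\prod_(1 <= j < _) z j) (z _).
by move=> x y t u v; lra.
Qed.

End MarkedSum.

(** * Moments *)

Section EulerProduct.
Import Order.TTheory GRing.Theory Num.Theory numFieldNormedType.Exports.
Variable R : realType.

Lemma esum_geometric (x : R) : 0 <= x < 1 ->
  (\esum_(n in [set: nat]) (x ^+ n)%:E = ((1 - x)^-1)%:E)%E.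
Proof.
move=> /andP[x0 x1]; rewrite -nneseries_esumT => [|n]; last first.
  by rewrite lee_fin exprn_ge0.
have xn : `|x| < 1 by rewrite ger0_norm.
have -> : (fun n => \sum_(0 <= i < n) (x ^+ i)%:E)%E =
    EFin \o series (geometric 1 x).
  apply/funext => n /=; rewrite sumEFin; congr _%:E.
  by apply: eq_bigr => i _; rewrite /= mul1r.
have := cvg_geometric_series (a := 1) xn; rewrite mul1r => gc.
rewrite EFin_lim; first by rewrite (cvg_lim _ gc).
by apply/cvg_ex; exists (1 - x)^-1.
Qed.

Lemma smooth_cons_bij p (r : seq nat) : prime p -> p \notin r ->
  set_bij ([set: nat] `*` [set m | [pred q in r].-nat m])
    [set d | [pred q in p :: r].-nat d] (fun u => p ^ u.1 * u.2)%N.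
Proof.
move=> pp pr.
have logr m : [pred q in r].-nat m -> logn p m = 0%N.
  move=> mr; apply/eqP; rewrite -leqn0 leqNgt logn_gt0.
  by apply: contra pr => /(pnatPpi mr).
split=> [[a m] [_ /= mr]|[a m] [b m']|d /= dr].
- rewrite pnatM pnatX pnatE //= !inE eqxx /=.
  by apply: sub_in_pnat mr => q _; rewrite !inE => ->; rewrite orbT.
- rewrite !inE /= => -[_ mr] [_ mr'] E.
  have := congr1 (logn p) E.
  have m0 : (0 < m)%N by case/andP: mr.
  have m'0 : (0 < m')%N by case/andP: mr'.
  have p0 e : (0 < p ^ e)%N by rewrite expn_gt0 prime_gt0.
  rewrite !lognM // !pfactorK // !logr // !addn0 => ab.
  move/eqP: E; rewrite ab eqn_pmul2l // => /eqP->.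
  by [].
have d0 : (0 < d)%N by case/andP: dr.
exists (logn p d, partn d (negn p))%N; last by rewrite /= -p_part partnC.
split=> //=; apply/pnatP; rewrite ?part_gt0 // => q qp qd.
have : q \in p :: r.
  have /pnatP := dr; move=> /(_ d0 q qp); rewrite inE; apply.
  exact: dvdn_trans qd (dvdn_part _ _).
rewrite inE => /predU1P[qE|//].
have := pnat_dvd qd (part_pnat (negn p) d); rewrite pnatE // qE.
by rewrite !inE eqxx.
Qed.

Lemma prime_expV_lt1 q j : (0 < j)%N -> prime q -> q%:R ^- j < 1 :> R.
Proof.
move=> j0 qp; have q1 : 1 < q%:R :> R by rewrite ltr1n prime_gt1.
have q0 : 0 < q%:R :> R by apply: lt_trans q1.
by rewrite invf_lt1 ?exprn_gt0 // exprn_egt1 // -lt0n.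
Qed.

(** Euler product by induction: separating the power of [p] factors the sum into a geometric series
    and the sum over the remaining primes. *)
Lemma esum_smooth (r : seq nat) j : (0 < j)%N -> all prime r -> uniq r ->
  (\esum_(d in [set d | [pred q in r].-nat d]) (d%:R ^- j)%:E =
   (\prod_(p <- r) (1 - p%:R ^- j)^-1 : R)%:E)%E.
Proof.
move=> j0; elim: r => [_ _|p r IHr /= /andP[pp rp] /andP[pr ur]].
  rewrite big_nil (_ : [set _ | _] = [set 1%N]); last first.
    apply/seteqP; split=> d /=; last by move=> ->.
    move=> /andP[d0 dP]; apply/eqP; rewrite eqn_leq d0 andbT leqNgt.
    apply/negP => d1; move/allP: dP => /(_ (pdiv d)).
    rewrite mem_primes pdiv_prime // d0 pdiv_dvd => /(_ isT).
    by rewrite inE.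
  by rewrite esum_set1 ?expr1n ?invr1 // lee_fin.
rewrite big_cons (reindex_esum _ _ _ _ (smooth_cons_bij pp pr)).
have p0 : 0 < p%:R :> R by rewrite ltr0n prime_gt0.
transitivity (\esum_(u in [set: nat] `*` [set m | [pred q in r].-nat m])
   (((p%:R ^- j) ^+ u.1)%:E * ((u.2%:R : R) ^- j)%:E))%E.
  apply: eq_esum => -[a m] _ /=; rewrite -EFinM; congr _%:E.
  by rewrite natrM natrX exprMn invfM -exprM mulnC exprM exprVn.
have := @esum_esum R _ _ [set: nat] (fun=> [set m | [pred q in r].-nat m])
  (fun a m => ((p%:R ^- j) ^+ a)%:E * (m%:R ^- j)%:E)%E.
have -> : [set: nat] `*`` (fun=> [set m | [pred q in r].-nat m]) =
   [set: nat] `*` [set m | [pred q in r].-nat m] by [].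
move=> <-; last first.
  move=> a m _ _; rewrite -EFinM lee_fin.
  by rewrite mulr_ge0 ?exprn_ge0 ?invr_ge0 ?exprn_ge0.
under eq_esum => a _.
  rewrite esumZl; last 2 first.
  - by rewrite exprn_gt0 // invr_gt0 exprn_gt0.
  - by move=> m _; rewrite lee_fin invr_ge0 exprn_ge0.
  rewrite IHr //; over.
rewrite esumZr; last 2 first.
- rewrite big_seq; apply: prodr_gt0 => q qr; rewrite invr_gt0 subr_gt0.
  by apply: prime_expV_lt1 => //; exact: (allP rp).
- by move=> a _; rewrite lee_fin exprn_ge0 // invr_ge0 exprn_ge0.
rewrite esum_geometric ?EFinM //; apply/andP; split.
  by rewrite invr_ge0 exprn_ge0.
exact: prime_expV_lt1.
Qed.

Lemma zetaPE (P : {fset nat}) j : (0 < j)%N ->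
  (forall p, p \in P -> prime p) ->
  zetaP R P j = (\prod_(p <- P) (1 - p%:R ^- j)^-1)%:E.
Proof.
by move=> j0 Pp; rewrite -esum_smooth ?fset_uniq //; apply/allP => p; exact: Pp.
Qed.

Definition qpoch_part (q : R) (n : nat) : R :=
  \prod_(0 <= i < n) (1 - q * q ^+ i).

(** This uniform bound keeps the limit away from 0. For [q <= 1/2] it follows from
    [1 - q - q^2 >= 1/4]; the extra term [q ^+ m.+2] in [bound] is what makes the induction
    close. *)
Lemma qpoch_part_ge (q : R) n : 0 <= q <= 2^-1 -> 4^-1 <= qpoch_part q n.
Proof.
move=> /andP[q0 q2].
have qn m : 0 <= q ^+ m by rewrite exprn_ge0.
have bound m : 1 - q - q ^+ 2 + q ^+ m.+2 <= qpoch_part q m.+1.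
  elim: m => [|m IHm].
    by rewrite /qpoch_part big_nat1 expr0; lra.
  rewrite /qpoch_part big_nat_recr //= -/(qpoch_part q m.+1).
  have x1 : q ^+ m.+2 <= q ^+ 2.
    rewrite -addn2 exprD ler_piMl ?exprn_ge0 // exprn_ile1 //; lra.
  have x2 : q ^+ 2 <= 1 by rewrite exprn_ile1 //; lra.
  have x0 := qn m.+2; rewrite -exprS.
  have -> : q ^+ m.+3 = q * q ^+ m.+2 by rewrite exprS.
  apply: le_trans (ler_wpM2r _ IHm); last by rewrite subr_ge0; lra.
  (* With [x = q ^+ m.+2], the right side of the goal exceeds the left by exactly
     [x * (q ^+ 2 - x)]. *)
  have : 0 <= q ^+ m.+2 * (q ^+ 2 - q ^+ m.+2) by rewrite mulr_ge0 // subr_ge0.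
  by move: (q ^+ m.+2) (q ^+ 2) => x y; nra.
case: n => [|n]; first by rewrite /qpoch_part big_geq // invf_le1 ?ler1n.
apply: le_trans (bound n); have := qn n.+2.
have : q * q <= 2^-1 * 2^-1 by apply: ler_pM.
rewrite expr2 => h1 h2; lra.
Qed.


End EulerProduct.

(** * The sum of [#Sur(G, H) / #Aut(G)] over all [G] *)

Section Moments.
Import Order.TTheory GRing.Theory Num.Theory numFieldNormedType.Exports.
Variable R : realType.

Lemma qpoch_part_cvg (q : R) : 0 <= q <= 2^-1 ->
  qpoch_part q n @[n --> \oo] --> qpoch q q.
Proof.
by move=> /andP[q0 q2]; apply: qpoch_is_cvg; apply/andP; split=> //; lra.
Qed.

Lemma qpoch_part_ge_lim (q : R) n : 0 <= q <= 2^-1 ->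
  qpoch q q <= qpoch_part q n.
Proof.
move=> q02; have /andP[q0 q2] := q02.
apply: (@nonincreasing_cvgn_ge _ (qpoch_part q)); last first.
  by apply/cvg_ex; exists (qpoch q q); exact: qpoch_part_cvg.
apply/nonincreasing_seqP => m; rewrite /qpoch_part big_nat_recr //=.
rewrite ler_piMr //; last by rewrite gerBl mulr_ge0 ?exprn_ge0.
apply: le_trans (qpoch_part_ge m q02); by rewrite invr_ge0.
Qed.

Lemma qpoch_gt0 (q : R) : 0 <= q <= 2^-1 -> 0 < qpoch q q.
Proof.
move=> q02; apply: (@lt_le_trans _ _ 4^-1); first by rewrite invr_gt0.
apply: (cvgr_to_ge (qpoch_part_cvg q02)).
by near=> n; exact: qpoch_part_ge.
Unshelve. all: by end_near.
Qed.

Lemma primeV_le_half p : prime p -> 0 <= (p%:R^-1 : R) <= 2^-1.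
Proof.
move=> pp; rewrite invr_ge0 ler0n /= lef_pV2 ?posrE ?ltr0n ?prime_gt0 //.
by rewrite ler_nat prime_gt1.
Qed.

(** Double count of the pairs of generating tuples [(s, t)] with the kernel of [s] inside that of
    [t]: by [card_sur_gens] each [s] occurs in [card_sur gT rT] of them. *)
Lemma sum_card_sur n (gT rT : finGroupType) :
  (card_sur gT rT * #|gens n gT| = \sum_(t in gens n rT)
    #|[set s in gens n gT | `[< wker s `<=` wker t >]]%SET|)%N.
Proof.
rewrite mulnC -sum_nat_const.
transitivity (\sum_(s in gens n gT)
  #|[set t in gens n rT | `[< wker s `<=` wker t >]]%SET|)%N.
  by apply: eq_bigr => s sG; rewrite card_sur_gens.
transitivity (\sum_(s in gens n gT) \sum_(t in gens n rT)
    `[< wker s `<=` wker t >])%N.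
  apply: eq_bigr => s _; rewrite -sum1_card big_mkcond [RHS]big_mkcond.
  apply: eq_bigr => t _; rewrite !inE.
  by case: (generates t) => //; case: asbool.
rewrite exchange_big /=; apply: eq_bigr => t _.
rewrite -sum1_card big_mkcond [RHS]big_mkcond.
by apply: eq_bigr => s _; rewrite !inE; case: (generates s) => //; case: asbool.
Qed.

Section Fixed.
Variable P : {fset nat}.
Hypothesis P_prime : forall p, p \in P -> prime p.

Definition mass_part n : R := \prod_(p <- P) qpoch_part p%:R^-1 n.

Definition mass : R := \prod_(p <- P) qpoch p%:R^-1 p%:R^-1.

Lemma cl_constE k : cl_const R k P = mass ^+ k.
Proof. by rewrite /cl_const prodrXl. Qed.

Lemma mass_gt0 : 0 < mass.
Proof.
rewrite /mass big_seq; apply: prodr_gt0 => p /P_prime pp.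
exact/qpoch_gt0/primeV_le_half.
Qed.

Lemma mass_le n : mass <= mass_part n.
Proof.
rewrite /mass /mass_part big_seq [leRHS]big_seq.
apply: ler_prod => p /P_prime pp.
rewrite qpoch_part_ge_lim ?primeV_le_half // andbT ltW //.
exact/qpoch_gt0/primeV_le_half.
Qed.

Lemma mass_part_cvg : mass_part n @[n --> \oo] --> mass.
Proof.
rewrite /mass [X in _ --> X]big_seq.
have -> : mass_part = (fun n => \prod_(p <- P | p \in P) qpoch_part p%:R^-1 n).
  by apply/funext => n; rewrite /mass_part big_seq.
apply: cvg_big => [|p /P_prime pp]; first exact: mul_continuous.
exact/qpoch_part_cvg/primeV_le_half.
Qed.

(** The factor of index [i] in [qpoch_part] is [1 - q ^+ i.+1], so the zeta value at [j] supplies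
    the inverses of the factors of index [j - 1]. *)
Lemma prod_zeta n :
  \prod_(1 <= j < n.+1) \prod_(p <- P) (1 - p%:R ^- j)^-1 =
  (mass_part n)^-1 :> R.
Proof.
rewrite exchange_big /= /mass_part -prodfV; apply: eq_bigr => p _.
rewrite /qpoch_part -prodfV big_add1; apply: eq_bigr => i _.
by rewrite -exprS exprVn.
Qed.

Definition gens_ratio n (gT : finGroupType) : R :=
  #|gens n gT|%:R / #|gT|%:R ^+ n.

Lemma card_gT_gt0 (gT : finGroupType) : (0 < #|gT|)%N.
Proof. by rewrite -cardsT cardG_gt0. Qed.

Lemma gens_ratio_ge0 n gT : 0 <= gens_ratio n gT.
Proof. by rewrite divr_ge0 ?exprn_ge0. Qed.

Lemma gens_ratio_le1 n gT : gens_ratio n gT <= 1.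
Proof.
rewrite ler_pdivrMr ?exprn_gt0 ?ltr0n ?card_gT_gt0 // mul1r -natrX ler_nat.
by rewrite -card_tuple max_card.
Qed.

Lemma gens_ratio_ge n (gT : finGroupType) :
  1 - #|{group gT}|%:R * 2^-1 ^+ n <= gens_ratio n gT.
Proof.
have G0 : 0 < #|gT|%:R ^+ n :> R by rewrite exprn_gt0 ?ltr0n ?card_gT_gt0.
rewrite lerBlDr -lerBlDl exprVn ler_pdivlMr ?exprn_gt0 //.
have -> : 1 - gens_ratio n gT = #|~: gens n gT|%:R / #|gT|%:R ^+ n.
  rewrite -[X in X - _](divff (lt0r_neq0 G0)) -mulrBl; congr (_ / _).
  by rewrite -natrX -card_tuple -(cardsC (gens n gT)) natrD addrC addKr.
rewrite mulrAC ler_pdivrMr // -!natrX -!natrM ler_nat.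
exact: card_not_gens.
Qed.

Lemma gens_ratio_cvg (gT : finGroupType) :
  gens_ratio n gT @[n --> \oo] --> (1 : R).
Proof.
apply: (@squeeze_cvgr _ _ _ _
  (fun n => 1 - #|{group gT}|%:R * 2^-1 ^+ n) (cst 1)).
- by near=> n; rewrite gens_ratio_ge gens_ratio_le1.
- rewrite -[X in _ --> X]subr0; apply: cvgB; first exact: cvg_cst.
  apply: (@cvg_geometric R #|{group gT}|%:R 2^-1).
  by rewrite ger0_norm ?invf_lt1 ?ltr1n.
exact: cvg_cst.
Unshelve. all: by end_near.
Qed.

(** The surjections are spread over the generating tuples [t] of [hT]; [marked_sum] gives each [t]
    the same contribution, since each generates all of [hT]. *)
Lemma esum_sur_gens (hT : finGroupType) n :
  abelian_group hT -> pi_group P hT ->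
  (\esum_(G in reps P)
    ((card_sur G hT)%:R / (card_aut G)%:R * gens_ratio n G)%:E =
   (gens_ratio n hT * (mass_part n)^-1)%:E)%E.
Proof.
move=> hT_ab hT_pi.
have zE j : (0 < j)%N -> zetaP R P j = (\prod_(p <- P) (1 - p%:R ^- j)^-1)%:E.
  by move=> j0; exact: zetaPE.
transitivity (\esum_(G in reps P) \sum_(t in gens n hT)
   (#|[set s in gens n G | `[< wker s `<=` wker t >]]%SET|%:R *
      (#|G|%:R ^- n / (card_aut G)%:R) : R)%:E)%E.
  apply: eq_esum => G _; rewrite sumEFin; congr _%:E.
  rewrite -mulr_suml /gens_ratio -!mulrA.
  rewrite [_^-1 * (_ / _)]mulrCA [_ ^- n * _]mulrC !mulrA; congr (_ / _ / _).
  rewrite -natrM -natr_sum; congr _%:R.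
  exact: sum_card_sur.
rewrite esum_sum; last first.
  by move=> G t _ _; rewrite lee_fin mulr_ge0 // divr_ge0 ?invr_ge0 ?exprn_ge0.
transitivity (\sum_(t in gens n hT) (#|hT|%:R ^- n * (mass_part n)^-1)%:E)%E.
  apply: eq_bigr => t; rewrite inE => tT.
  rewrite (esum_marked P n (wker t) (f := fun m => m%:R ^- n)); last first.
    by move=> m; rewrite invr_ge0 exprn_ge0.
  have := marked_sum t hT_ab hT_pi zE.
  by rewrite size_tuple (eqP tT) cardsT prod_zeta => ->.
rewrite sumEFin sumr_const; congr _%:E.
by rewrite -[LHS]mulr_natl /gens_ratio mulrA.
Qed.

(** Limit of [esum_sur_gens] as [n] grows, one inequality at a time, which avoids exchanging the
    limit with the infinite sum. *)
Lemma esum_sur (hT : finGroupType) :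
  abelian_group hT -> pi_group P hT ->
  (\esum_(G in reps P) ((card_sur G hT)%:R / (card_aut G)%:R)%:E =
   (mass^-1)%:E)%E.
Proof.
move=> hT_ab hT_pi.
have m0 := mass_gt0.
have mp0 n : 0 < mass_part n by apply: lt_le_trans (mass_le n).
have a0 (G : finAbGroup) : 0 <= (card_sur G hT)%:R / (card_aut G)%:R :> R.
  by rewrite divr_ge0.
have up : (\esum_(G in reps P) ((card_sur G hT)%:R / (card_aut G)%:R)%:E <=
   (mass^-1)%:E)%E.
  apply: esum_le => Y YP; rewrite sumEFin lee_fin.
  (* On the finite set [Y] the proportions tend to 1 together, while for each [n] the finite sum is
     at most [(mass_part n)^-1 <= mass^-1]. *)
  have : (\sum_(G <- Y) (card_sur G hT)%:R / (card_aut G)%:R * gens_ratio n G)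
      @[n --> \oo] -->
      (\sum_(G <- Y) (card_sur G hT)%:R / (card_aut G)%:R * 1 : R).
    apply: cvg_big => [|G _]; first exact: add_continuous.
    by apply: cvgM; [exact: cvg_cst|exact: gens_ratio_cvg].
  under [X in _ --> X -> _]eq_bigr do rewrite mulr1.
  move/cvgr_to_le; apply; near=> n.
  rewrite -lee_fin -sumEFin.
  apply: le_trans (esum_ge_fset _ YP) _.
  rewrite esum_sur_gens // lee_fin -[leRHS]mul1r.
  apply: ler_pM; first exact: gens_ratio_ge0.
  - by rewrite invr_ge0 ltW.
  - exact: gens_ratio_le1.
  by rewrite lef_pV2 ?posrE // mass_le.
apply/eqP; rewrite eq_le up /=.
set S := esum _ _ in up *.
have S_fin : S \is a fin_num.
  rewrite ge0_fin_numE; first exact: le_lt_trans up (ltry _).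
  by apply: esum_ge0 => G _; rewrite lee_fin.
rewrite -(fineK S_fin) lee_fin.
(* Proportions are at most 1, so for each [n] the sum without them is at least the right side of
   [esum_sur_gens]; that side tends to [mass^-1]. *)
have : gens_ratio n hT * (mass_part n)^-1 @[n --> \oo] --> 1 * mass^-1.
  apply: cvgM; first exact: gens_ratio_cvg.
  by apply: cvgV; [exact: lt0r_neq0|exact: mass_part_cvg].
rewrite mul1r => /cvgr_to_le; apply; near=> n.
rewrite -lee_fin fineK // -esum_sur_gens //; apply: le_esum => G _.
by rewrite lee_fin ler_piMr ?gens_ratio_le1.
Unshelve. all: by end_near.
Qed.

End Fixed.
End Moments.

(** * Sequences with given types *)

Section Chains.
Import GroupScope.

Definition card_seqiso (k : nat) (P : {fset nat}) (G H : abseq k P) : nat :=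
  #|[set f : {dffun forall i : 'I_k, {ffun G i -> H i}} |
     `[< is_seqiso (G := G) (H := H) (fun i => f i) >]]%SET|.

Lemma card_seqaut_iso k P (G : abseq k P) : card_seqaut G = card_seqiso G G.
Proof. by rewrite /card_seqaut /card_seqiso cardsE. Qed.

Lemma is_seqiso_comp k P (G H K : abseq k P) f g :
  is_seqiso (G := G) (H := H) f -> is_seqiso (G := H) (H := K) g ->
  is_seqiso (G := G) (H := K) (fun i => g i \o f i).
Proof.
move=> [fi fc] [gi gc]; split=> [i|i j ij x /=]; last by rewrite fc gc.
have /misom_setTP[fM fb] := fi i; have /misom_setTP[gM gb] := gi i.
apply/misom_setTP; split; last exact: bij_comp.
by move=> x y; rewrite /= fM gM.
Qed.

Lemma eq_is_seqiso k P (G H : abseq k P) f g : (forall i, f i =1 g i) ->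
  is_seqiso (G := G) (H := H) f -> is_seqiso (G := G) (H := H) g.
Proof.
move=> fg; have E : f = g.
  by apply/(@functional_extensionality_dep _ _ f g) => i; apply/funext.
by rewrite E.
Qed.

Lemma card_seqiso_le k P (G H K : abseq k P) :
  seqiso H K -> (card_seqiso G H <= card_seqiso G K)%N.
Proof.
move=> [h hiso]; have hinj i : injective (h i).
  by case: hiso => hi _; have /misom_setTP[_] := hi i; exact: bij_inj.
pose F (f : {dffun forall i : 'I_k, {ffun G i -> H i}}) :
  {dffun forall i : 'I_k, {ffun G i -> K i}} :=
  [ffun i => [ffun x => h i (f i x)]].
have Finj : injective F.
  move=> f g /ffunP FE; apply/ffunP => i; apply/ffunP => x.
  by apply: (hinj i); have /ffunP/(_ x) := FE i; rewrite !ffunE.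
rewrite /card_seqiso -(card_imset _ Finj); apply: subset_leq_card.
apply/fintype.subsetP => y /imsetP[f]; rewrite inE => /asboolP fiso ->.
rewrite inE; apply/asboolP; apply: eq_is_seqiso (is_seqiso_comp fiso hiso).
by move=> i x; rewrite !ffunE.
Qed.

Lemma card_seqiso_ge k P (G H K : abseq k P) :
  seqiso H G -> (card_seqiso G K <= card_seqiso H K)%N.
Proof.
move=> [h hiso]; have hsurj i y : exists x, h i x = y.
  case: hiso => hi _; have /misom_setTP[_ [g hK gK]] := hi i.
  by exists (g y).
pose F (f : {dffun forall i : 'I_k, {ffun G i -> K i}}) :
  {dffun forall i : 'I_k, {ffun H i -> K i}} :=
  [ffun i => [ffun x => f i (h i x)]].
have Finj : injective F.
  move=> f g /ffunP FE; apply/ffunP => i; apply/ffunP => y.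
  have [x <-] := hsurj i y.
  by have /ffunP/(_ x) := FE i; rewrite !ffunE.
rewrite /card_seqiso -(card_imset _ Finj); apply: subset_leq_card.
apply/fintype.subsetP => y /imsetP[f]; rewrite inE => /asboolP fiso ->.
rewrite inE; apply/asboolP; apply: eq_is_seqiso (is_seqiso_comp hiso fiso).
by move=> i x; rewrite !ffunE.
Qed.

(** Composition with one isomorphism between [G] and [H] matches the isomorphisms from [G] to [H]
    with the automorphisms of [G]. *)
Lemma card_seqiso_aut k P (G H : abseq k P) :
  card_seqiso G H = if `[< seqiso G H >] then card_seqaut G else 0%N.
Proof.
case: asboolP => GH.
  rewrite card_seqaut_iso; apply/eqP; rewrite eqn_leq.
  by rewrite !card_seqiso_le //; exact: seqiso_sym.
apply: eq_card0 => f; rewrite inE; apply/asboolP => fiso; apply: GH.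
by exists (fun i x => f i x).
Qed.

Lemma card_seqaut_gt0 k P (G : abseq k P) : (0 < card_seqaut G)%N.
Proof.
rewrite card_seqaut_iso; apply/card_gt0P.
have [f fiso] := seqiso_refl G.
exists [ffun i => [ffun x => f i x]]; rewrite inE; apply/asboolP.
by apply: eq_is_seqiso fiso => i x; rewrite !ffunE.
Qed.

Lemma card_seqaut_eq k P (G H : abseq k P) :
  seqiso G H -> card_seqaut G = card_seqaut H.
Proof.
have le (G' H' : abseq k P) :
    seqiso G' H' -> (card_seqaut G' <= card_seqaut H')%N.
  move=> GH; have HG := seqiso_sym GH; rewrite card_seqaut_iso.
  apply: leq_trans (card_seqiso_ge _ HG) _.
  by rewrite card_seqiso_aut asboolT.
by move=> GH; apply/eqP; rewrite eqn_leq !le //; exact: seqiso_sym.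
Qed.

Definition surs (gT rT : finGroupType) : {set {ffun gT -> rT}} :=
  [set f : {ffun gT -> rT} | morphic [set: gT]%SET f &
    f @: [set: gT]%SET == [set: rT]%SET]%SET.

Definition isos (gT rT : finGroupType) : {set {ffun gT -> rT}} :=
  [set f : {ffun gT -> rT} | misom [set: gT]%SET [set: rT]%SET f]%SET.

Lemma card_isos (gT : finGroupType) : #|isos gT gT| = card_aut gT.
Proof.
pose F (a : {perm gT}) : {ffun gT -> gT} := [ffun x => a x].
have Finj : injective F.
  by move=> a b /ffunP ab; apply/permP => x; have := ab x; rewrite !ffunE.
rewrite /card_aut -(card_imset _ Finj); apply: eq_card => f; rewrite inE.
apply/misom_setTP/imsetP => [[fM fb]|[a /mem_Aut_setT aM ->]].
  exists (perm (bij_inj fb)); last by apply/ffunP => x; rewrite ffunE permE.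
  by apply/mem_Aut_setT => x y; rewrite !permE.
split=> [x y|]; first by rewrite !ffunE aM.
by exists (fun x => a^-1%g x) => x; rewrite ffunE ?permK ?permKV.
Qed.

Lemma card_family_prod (aT : finType) (rT : aT -> finType)
    (F : forall x, pred (rT x)) :
  #|(family F : simpl_pred {dffun forall x : aT, rT x})| =
  (\prod_(x : aT) #|F x|)%N.
Proof.
rewrite card_family -big_enum /= /image_mem.
by elim: (enum aT) => [|x r IHr]; rewrite ?big_nil // big_cons /= IHr.
Qed.

Section FixedGroups.
Variables (k : nat) (P : {fset nat}) (B : nat -> finAbGroup).
Hypothesis B_pi : forall i : 'I_k, i.+1 = k -> pi_group P (B i.+1).

(* A chain of surjections B k ->> ... ->> B 1 is stored on all pairs of
   indices, with the trivial map where the indices are not consecutive: this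
   avoids any transport between B j and B i.+1 when j = i.+1. *)
Definition link (u : 'I_k * 'I_k) : pred {ffun B u.2.+1 -> B u.1.+1} :=
  fun f => if u.2 == u.1.+1 :> nat then f \in surs _ _ else f == [ffun=> 1].

Definition chain : finType :=
  {s : {dffun forall u : 'I_k * 'I_k, {ffun B u.2.+1 -> B u.1.+1}} |
     s \in family link}.

Definition chain_map (s : chain) (i j : 'I_k) : B j.+1 -> B i.+1 :=
  val s (i, j).

Lemma link_succ (i j : 'I_k) (f : {ffun B j.+1 -> B i.+1}) :
  j = i.+1 :> nat -> link (u := (i, j)) f = (f \in surs (B j.+1) (B i.+1)).
Proof. by move=> ij; rewrite /link; case: eqP. Qed.

Lemma link_nsucc (i j : 'I_k) (f : {ffun B j.+1 -> B i.+1}) :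
  j <> i.+1 :> nat -> link (u := (i, j)) f = (f == [ffun=> 1]).
Proof. by move=> ij; rewrite /link; case: eqP. Qed.

Lemma chain_link (s : chain) u : link (val s u).
Proof. by have /familyP/(_ u) := valP s. Qed.

Lemma chain_surs (s : chain) (i j : 'I_k) : j = i.+1 :> nat ->
  val s (i, j) \in surs (B j.+1) (B i.+1).
Proof. by move=> ij; rewrite -link_succ //; exact: chain_link. Qed.

Lemma chain_morph (s : chain) (i j : 'I_k) : j = i.+1 :> nat ->
  {in [set: B j.+1]%SET &, {morph @chain_map s i j : x y / x * y}}.
Proof.
move=> ij; have := chain_surs s ij; rewrite inE => /andP[/morphicP fM _].
by [].
Qed.

Lemma chain_surj (s : chain) (i j : 'I_k) (ij : j = i.+1 :> nat) :
  Morphism (chain_morph s ij) @* [set: B j.+1]%SET = [set: B i.+1]%SET.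
Proof.
have := chain_surs s ij; rewrite inE => /andP[_ /eqP fT].
by rewrite morphimEdom.
Qed.

Definition chain_seq (s : chain) : abseq k P :=
  @AbSeq k P (fun i => B i.+1) (fun i j ij => Morphism (chain_morph s ij))
    (chain_surj s) B_pi.

(** Transport of structure: the map from [B j.+1] to [B i.+1] has to be [absurj] conjugated by the
    bijections [f]. *)
Lemma chain_transport (G : abseq k P) (f : forall i : 'I_k, G i -> B i.+1) :
  (forall i, misom [set: G i]%SET [set: B i.+1]%SET (f i)) ->
  exists s : chain, is_seqiso (G := G) (H := chain_seq s) f.
Proof.
move=> f_iso.
have fX (i : 'I_k) :
    {g : B i.+1 -> G i | cancel (f i) g & cancel g (f i)}.
  have /misom_setTP[_ f_bij] := f_iso i.
  exists (fun y => iinv (mem_codom_bij f_bij y)).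
    by move=> x; apply: (bij_inj f_bij); exact: f_iinv.
  by move=> y; exact: f_iinv.
pose g (i : 'I_k) := s2val (fX i).
have fK (i : 'I_k) : cancel (f i) (g i) by rewrite /g; case: (fX i).
have gK (i : 'I_k) : cancel (g i) (f i) by rewrite /g; case: (fX i).
have fM (i : 'I_k) : {morph f i : x y / x * y}.
  by have /misom_setTP[] := f_iso i.
have gM (i : 'I_k) : {morph g i : x y / x * y}.
  by move=> x y; apply: (can_inj (fK i)); rewrite fM !gK.
(* The case analysis on the equality yields the proof [ij] that [absurj] takes as an argument; by
   proof irrelevance any other proof gives the same map. *)
pose F (u : 'I_k * 'I_k) : {ffun B u.2.+1 -> B u.1.+1} :=
  if u.2 =P u.1.+1 :> nat is ReflectT ij
  then [ffun y => f u.1 (absurj G ij (g u.2 y))] else [ffun=> 1].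
have FE (i j : 'I_k) (ij : j = i.+1 :> nat) y :
    F (i, j) y = f i (absurj G ij (g j y)).
  rewrite /F /=; case: eqP => // ij'; rewrite ffunE.
  by rewrite (Prop_irrelevance ij' ij).
have FX : [ffun u => F u] \in family link.
  apply/familyP => -[i j]; rewrite ffunE.
  have [ij|ij] := eqVneq (j : nat) i.+1; last first.
    have nij : j <> i.+1 :> nat by apply/eqP.
    rewrite [_ \in _]link_nsucc // /F /=.
    by case: eqP.
  rewrite [_ \in _]link_succ // inE; apply/andP; split.
    apply/morphicP => x y _ _; rewrite !(FE i j ij) gM.
    by rewrite morphM ?inE // fM.
  apply/eqP/setP => y; rewrite [RHS]inE; apply/imsetP.
  have : g i y \in absurj G ij @* [set: G j]%SET by rewrite absurjP inE.
  case/morphimP => x _ _ gx; exists (f j x); rewrite ?inE //.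
  by rewrite (FE i j ij) fK -gx gK.
exists (exist (fun s => s \in family link) _ FX); split=> // i j ij x.
rewrite /= /chain_map /= ffunE (FE i j ij) fK.
by [].
Qed.

(** Each [f j] is onto, so compatibility with [f] determines every map of the chain; between other
    indices [link] allows one value only. *)
Lemma chain_transport_uniq (s t : chain) (G : abseq k P)
    (f : forall i : 'I_k, G i -> B i.+1) :
  (forall i, misom [set: G i]%SET [set: B i.+1]%SET (f i)) ->
  is_seqiso (G := G) (H := chain_seq s) f ->
  is_seqiso (G := G) (H := chain_seq t) f -> s = t.
Proof.
move=> f_iso [_ fs] [_ ft]; apply: val_inj; apply/ffunP => -[i j].
have [ij|ij] := eqVneq (j : nat) i.+1; last first.
  have nij : j <> i.+1 :> nat by apply/eqP.
  have := chain_link s (i, j); rewrite link_nsucc // => /eqP ->.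
  by have := chain_link t (i, j); rewrite link_nsucc // => /eqP ->.
apply/ffunP => y; have /misom_setTP[_ [g fK gK]] := f_iso j.
have := fs i j ij (g y); rewrite (ft i j ij (g y)) gK.
by [].
Qed.

Lemma card_chain : #|chain| = (\prod_(i < k) \prod_(j < k)
  (if j == i.+1 :> nat then card_sur (B j.+1) (B i.+1) else 1))%N.
Proof.
rewrite card_sig card_family_prod pair_bigA /=; apply: eq_bigr => -[i j] _.
case: ifP => [/eqP ij|/eqP nij].
  by apply: eq_card => f; rewrite -[LHS]/(link f) link_succ.
rewrite -(card1 ([ffun=> 1] : {ffun B j.+1 -> B i.+1})).
by apply: eq_card => f; rewrite -[LHS]/(link f) link_nsucc.
Qed.

(** Orbit counting: each tuple of automorphisms of the groups [B i.+1] is an isomorphism from [s] to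
    exactly one chain [t], its transport. *)
Lemma sum_card_seqiso (s : chain) :
  (\sum_(t : chain) card_seqiso (chain_seq s) (chain_seq t) =
   \prod_(i < k) card_aut (B i.+1))%N.
Proof.
pose T := {dffun forall i : 'I_k, {ffun B i.+1 -> B i.+1}}.
pose is_iso (t : chain) (f : T) :=
  `[< is_seqiso (G := chain_seq s) (H := chain_seq t) (fun i => f i) >].
pose Gam : pred T :=
  family (fun i : 'I_k => [pred f in isos (B i.+1) (B i.+1)]).
transitivity (\sum_(t : chain) \sum_(f : T) is_iso t f)%N.
  apply: eq_bigr => t _; rewrite /card_seqiso -sum1_card big_mkcond.
  by apply: eq_bigr => f _; rewrite inE /is_iso; case: asbool.
rewrite exchange_big /=.
transitivity (\sum_(f in Gam) 1)%N; last first.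
  rewrite sum1_card card_family_prod; apply: eq_bigr => i _.
  by rewrite -card_isos; apply: eq_card => f.
rewrite [RHS]big_mkcond; apply: eq_bigr => f _.
case: ifP => [fG|fN].
  have f_iso (i : 'I_k) : misom [set: B i.+1]%SET [set: B i.+1]%SET (f i).
    by have /familyP/(_ i) := fG; rewrite inE.
  have [t tiso] := chain_transport (G := chain_seq s) f_iso.
  rewrite (bigD1 t) //= big1 ?addn0 => [|t' tt'].
    by rewrite /is_iso asboolT.
  rewrite /is_iso asboolF // => t'iso; move/eqP: tt'; apply.
  exact: (@chain_transport_uniq t' t (chain_seq s) _ f_iso t'iso tiso).
rewrite big1 // => t _; rewrite /is_iso asboolF // => -[f_iso _].
move/negP: fN; apply; apply/familyP => i; rewrite inE; exact: f_iso.
Qed.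

End FixedGroups.
End Chains.

(** * Mass of the classes with given isomorphism types *)

Section ClassMass.
Import Order.TTheory GRing.Theory Num.Theory.
Variables (R : realType) (k : nat) (P : {fset nat}).

Definition class_repr (c : isoclass k P) : abseq k P :=
  projT1 (cid (class_eltsP c)).

Lemma class_reprK c : isoclass_of (class_repr c) = c.
Proof.
rewrite /class_repr; case: cid => G /=; case: c => E EP /= EG.
rewrite /isoclass_of; move: EP; rewrite EG => EP.
by congr IsoClass; exact: Prop_irrelevance.
Qed.

Lemma class_repr_iso (G : abseq k P) : seqiso (class_repr (isoclass_of G)) G.
Proof. by apply/isoclass_ofP; rewrite class_reprK. Qed.

Definition class_mass (c : isoclass k P) : R :=
  cl_const R k P / (card_seqaut (class_repr c))%:R.

Lemma class_massE G :
  class_mass (isoclass_of G) = cl_const R k P / (card_seqaut G)%:R.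
Proof. by rewrite /class_mass (card_seqaut_eq (class_repr_iso G)). Qed.

Definition with_types (B : nat -> finGroupType) : set (isoclass k P) :=
  [set isoclass_of G | G in
    [set G : abseq k P | forall j : 'I_k, isomorphic (G j) (B j.+1)]].

(** The classes with types [B] are the orbits of the chains. With [A] the product of the
    [card_aut (B i.+1)], the orbit of [s] has [A / card_seqaut] elements, so a mass of
    [cl_const / A] on each chain adds up to the mass of its class. *)
Lemma esum_with_types_chain (B : nat -> finAbGroup)
    (B_pi : forall i : 'I_k, i.+1 = k -> pi_group P (B i.+1)) :
  0 <= cl_const R k P ->
  (\esum_(c in with_types B) (class_mass c)%:E =
   (cl_const R k P *
     (#|chain k B|%:R / (\prod_(i < k) card_aut (B i.+1))%:R))%:E)%E.
Proof.
move=> cl0; set A := (\prod_(i < k) _)%N.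
have A0 : (0 < A)%N by apply: prodn_gt0 => i; exact: card_aut_gt0.
pose f (s : chain k B) := isoclass_of (chain_seq B_pi s).
have fT s : with_types B (f s).
  exists (chain_seq B_pi s) => // j; exact: isomorphic_refl.
rewrite mulrCA -[X in X * _]/(#|{: chain k B}|%:R) -esum_const; last first.
  by rewrite divr_ge0.
rewrite (esum_fiber (C := with_types B) (f := f)); last 2 first.
- by move=> s _; exact: fT.
- by move=> s _; rewrite lee_fin divr_ge0.
apply: eq_esum => c [G Gtypes <-]; rewrite class_massE.
have [s Gs] : exists s, seqiso G (chain_seq B_pi s).
  have fX (i : 'I_k) : {g : G i -> B i.+1 |
      misom [set: G i]%SET [set: B i.+1]%SET g}.
    apply/cid; have /isomorphicP[g gM gb] := Gtypes i.
    by exists g; apply/misom_setTP.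
  have [s sP] := chain_transport B_pi (fun i => projT2 (fX i)).
  by exists s, (fun i => projT1 (fX i)).
have -> : isoclass_of G = f s by apply/isoclass_ofP.
rewrite (card_seqaut_eq Gs).
have -> : [set x | x \in {: chain k B}] `&` f @^-1` [set f s] =
    [set t | t \in [pred t : chain k B |
      `[< seqiso (chain_seq B_pi s) (chain_seq B_pi t) >]]].
  apply/seteqP; split=> t /=; rewrite !inE.
    by move=> [_ /isoclass_ofP]; exact: seqiso_sym.
  by move=> st; split=> //; apply/isoclass_ofP; exact: seqiso_sym.
rewrite esum_const ?divr_ge0 //; congr _%:E.
have := sum_card_seqiso B_pi s; rewrite -/A.
under eq_bigr do rewrite card_seqiso_aut.
rewrite -big_mkcond sum_nat_const => AE.
have aut0 : (card_seqaut (chain_seq B_pi s))%:R != 0 :> R.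
  by rewrite pnatr_eq0 -lt0n card_seqaut_gt0.
have A0' : A%:R != 0 :> R by rewrite pnatr_eq0 -lt0n.
apply: (mulIf A0'); rewrite -[RHS]mulrA divfK // -AE natrM mulrCA.
by rewrite divfK.
Qed.

Lemma card_sur_trivial (gT rT : finGroupType) :
  #|rT| = 1%N -> card_sur gT rT = 1%N.
Proof.
move=> /fintype1[z zE]; have r1 (x : rT) : x = 1%g.
  exact: etrans (zE x) (esym (zE _)).
rewrite -(card1 ([ffun=> 1%g] : {ffun gT -> rT})); apply: eq_card => f.
rewrite !inE; have -> : f = [ffun=> 1%g].
  by apply/ffunP => x; exact: etrans (r1 _) (esym (r1 _)).
rewrite eqxx; apply/andP; split.
  by apply/morphicP => x y _ _; rewrite !ffunE mulg1.
apply/eqP/setP => y; rewrite [RHS]inE; apply/imsetP.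
by exists 1%g; rewrite ?inE //; exact: etrans (r1 _) (esym (r1 _)).
Qed.

(** For each index [j > 0] only the pair [(j - 1, j)] contributes to the double product. For [j = 0]
    there is no such pair, in agreement with the single surjection onto the trivial [B 0]. *)
Lemma card_chain_prod (B : nat -> finAbGroup) : #|B 0%N| = 1%N ->
  #|chain k B| = (\prod_(i < k) card_sur (B i.+1) (B i))%N.
Proof.
move=> B0; rewrite card_chain exchange_big /=; apply: eq_bigr => -[[|j] jk] _.
  by rewrite big1 //= card_sur_trivial.
have jk' : (j < k)%N by apply: ltnW.
rewrite (bigD1 (Ordinal jk')) //= eqxx big1 ?muln1 // => i ij.
case: ifP => // /eqP[ji]; move/eqP: ij => []; exact: val_inj.
Qed.

Lemma esum_with_types_finab (B : nat -> finAbGroup) :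
  0 <= cl_const R k P -> #|B 0%N| = 1%N ->
  (forall i : 'I_k, i.+1 = k -> pi_group P (B i.+1)) ->
  (\esum_(c in with_types B) (class_mass c)%:E =
   (cl_const R k P * \prod_(1 <= i < k.+1)
      ((card_sur (B i) (B i.-1))%:R / (card_aut (B i))%:R))%:E)%E.
Proof.
move=> cl0 B0 B_pi; rewrite esum_with_types_chain //; congr (_ * _)%:E.
rewrite card_chain_prod // !natr_prod -prodf_div big_add1 big_mkord.
by [].
Qed.

Lemma with_types_iso (B B' : nat -> finGroupType) :
  (forall i, (1 <= i <= k)%N -> isomorphic (B i) (B' i)) ->
  with_types B = with_types B'.
Proof.
move=> BB'; apply/seteqP; split=> c [G GB <-]; exists G => // j.
  by apply: isomorphic_trans (GB j) _; apply: BB'; rewrite ltn_ord.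
apply: isomorphic_trans (GB j) _; apply: isomorphic_sym.
by apply: BB'; rewrite ltn_ord.
Qed.

Lemma esum_with_types (B : nat -> finGroupType) :
  0 <= cl_const R k P -> #|B 0%N| = 1%N ->
  (forall i, (1 <= i <= k)%N -> abelian_group (B i) /\ pi_group P (B i)) ->
  (\esum_(c in with_types B) (class_mass c)%:E =
   (cl_const R k P * \prod_(1 <= i < k.+1)
      ((card_sur (B i) (B i.-1))%:R / (card_aut (B i))%:R))%:E)%E.
Proof.
move=> cl0 B0 BP.
have B_ab i : (i <= k)%N -> abelian_group (B i).
  case: i => [_|i ik]; last by case: (BP i.+1 ik).
  have [z zE] := fintype1 B0.
  apply/centsP => x _ y _; exact: etrans (zE _) (esym (zE _)).
(* The groups are replaced by models with carriers in [Set]; an index above [k] where [B i] is not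
   abelian gets the trivial group. *)
pose B' i : finAbGroup :=
  if pselect (abelian_group (B i)) is left h then small_model h
  else trivial_group.
have BB' i : (i <= k)%N -> isomorphic (B i) (B' i).
  move=> ik; rewrite /B'; case: pselect => [h|/(_ (B_ab i ik))] //.
  exact: small_modelP.
rewrite (@with_types_iso B B'); last by move=> i /andP[_ ik]; exact: BB'.
rewrite esum_with_types_finab //.
- congr (_ * _)%:E; apply: eq_big_nat => i /andP[i1 ik].
  rewrite (card_aut_iso (BB' i ik)) (card_sur_iso (BB' i ik) (BB' i.-1 _)) //.
  exact: leq_trans (leq_pred i) _.
- by rewrite -(card_iso (BB' 0%N isT)).
move=> i ik; rewrite -(pi_group_iso _ (BB' i.+1 _)) ?ik //.
by have [] := BP i.+1; rewrite //= ik.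
Qed.

Definition class_measure (A : set (isoclass k P)) : \bar R :=
  (\esum_(c in A) (class_mass c)%:E)%E.

End ClassMass.

(** * Total mass *)

Section TotalMass.
Import Order.TTheory GRing.Theory Num.Theory.
Variables (R : realType) (P : {fset nat}).
Hypothesis P_prime : forall p, p \in P -> prime p.

(* The list [:: B_k; ...; B_1] of the isomorphism types of a sequence. *)
Definition type_lists (n : nat) : set (seq finAbGroup) :=
  [set l | size l = n /\ forall G, G \in l -> reps P G].

(** The default of [head] puts the trivial group [B_0] below [B_1]. *)
Fixpoint list_weight (l : seq finAbGroup) : R :=
  if l is G :: l' then
    (card_sur G (head trivial_group l'))%:R / (card_aut G)%:R * list_weight l'
  else 1.

Lemma list_weight_ge0 l : 0 <= list_weight l.
Proof. by elim: l => //= G l IHl; rewrite mulr_ge0 // divr_ge0. Qed.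

(** The list runs from the top group down. Index 0 falls just past its end, where the default stands
    for [B_0]. *)
Definition type_seq (l : seq finAbGroup) (i : nat) : finAbGroup :=
  nth trivial_group l (size l - i).

Lemma list_weightE l : list_weight l =
  \prod_(1 <= i < (size l).+1)
    ((card_sur (type_seq l i) (type_seq l i.-1))%:R /
     (card_aut (type_seq l i))%:R).
Proof.
elim: l => [|G l IHl]; first by rewrite big_geq.
have top : type_seq (G :: l) (size l).+1 = G by rewrite /type_seq /= subnn.
have below : type_seq (G :: l) (size l) = head trivial_group l.
  by rewrite /type_seq /= subSnn /= nth0.
rewrite [size (G :: l)]/= big_nat_recr // [(_.+1).-1]/= top below.
rewrite [LHS]/= IHl mulrC; congr (_ * _).
apply: eq_big_nat => i /andP[i1 il].
have tE j : (j <= size l)%N -> type_seq (G :: l) j = type_seq l j.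
  by move=> jl; rewrite /type_seq /= subSn.
by rewrite !tE //; exact: leq_trans (leq_pred i) _.
Qed.

Lemma trivial_card : #|trivial_group| = 1%N.
Proof.
by rewrite -(card_iso (small_modelP trivial_abelian)) card_Sn.
Qed.

Lemma trivial_group_pi : pi_group P trivial_group.
Proof. by rewrite pi_groupE trivial_card. Qed.

Lemma type_lists_bij n :
  set_bij (type_lists n `*` reps P) (type_lists n.+1) (fun u => u.2 :: u.1).
Proof.
split=> [[l G] [[/= sl lP] GP]|[l G] [l' G'] _ _ [-> ->] //|].
  by split=> /= [|H]; [rewrite sl|rewrite inE => /predU1P[->//|/lP]].
move=> [|G l] [//= [sl] lP].
exists (l, G) => //; split=> /=; last by apply: lP; rewrite mem_head.
by split=> // H Hl; apply: lP; rewrite inE Hl orbT.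
Qed.

(** The top group is summed first: by [esum_sur] its sum is [mass^-1] whatever the group below, so
    each further group contributes one such factor. *)
Lemma esum_list_weight n :
  (\esum_(l in type_lists n) (list_weight l)%:E =
   ((mass R P)^-1 ^+ n)%:E)%E.
Proof.
elim: n => [|n IHn].
  rewrite (_ : type_lists 0 = [set [::]]) ?esum_set1 // ?lee_fin //.
  apply/seteqP; split=> l /=; first by move=> [/size0nil].
  by move=> ->.
have m0 := mass_gt0 R P_prime.
rewrite (reindex_esum _ _ _ _ (type_lists_bij n)).
have := @esum_esum R _ _ (type_lists n) (fun=> reps P)
  (fun l G => (list_weight (G :: l))%:E).
have -> : type_lists n `*`` (fun=> reps P) = type_lists n `*` reps P by [].
move=> <-; last by move=> l G _ _; rewrite lee_fin list_weight_ge0.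
transitivity (\esum_(l in type_lists n)
    ((mass R P)^-1%:E * (list_weight l)%:E))%E.
  apply: eq_esum => l [_ lP].
  have head_pi : pi_group P (head trivial_group l).
    case: l lP => [_|G l lP /=]; first exact: trivial_group_pi.
    by case: (lP G (mem_head _ _)).
  rewrite -(esum_sur R P_prime (finab_abelian _) head_pi).
  (* A zero weight is set apart because [esumZr] asks for a positive constant. *)
  have [l0|l0] := eqVneq (list_weight l) 0.
    by rewrite l0 mule0 esum1 // => G _ /=; rewrite l0 mulr0.
  rewrite -esumZr.
  - by apply: eq_esum => G _; rewrite -EFinM.
  - by rewrite lt0r l0 list_weight_ge0.
  by move=> G _; rewrite lee_fin divr_ge0.
rewrite esumZl ?invr_gt0 // => [|l _]; last by rewrite lee_fin list_weight_ge0.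
by rewrite IHn -EFinM exprS.
Qed.

Section Length.
Variable k : nat.

(** Descending induction from the top group, where [abseq_pi] applies: the order of an image divides
    the order of the source. *)
Lemma abseq_all_pi (G : abseq k P) (i : 'I_k) : pi_group P (G i).
Proof.
have [n] := ubnP (k - i); elim: n i => // n IHn i.
have [ik|ik] := eqVneq i.+1 k; first by move=> _; exact: abseq_pi.
have lt_ik : (i.+1 < k)%N by rewrite ltn_neqAle ik ltn_ord.
rewrite ltnS => le_n.
have /IHn : (k - Ordinal lt_ik < n)%N.
  by apply: leq_trans le_n; rewrite /= subnS prednK // subn_gt0.
rewrite !pi_groupE; apply: smooth_dvd.
have ij : Ordinal lt_ik = i.+1 :> nat by [].
rewrite -cardsT -(absurjP G ij) -cardsT; exact: dvdn_morphim.
Qed.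

(** [rev_ord] lists the top group first, as in [type_lists]. *)
Definition class_types (c : isoclass k P) : seq finAbGroup :=
  [seq rep (class_repr c (rev_ord j)) | j : 'I_k].

Lemma size_class_types c : size (class_types c) = k.
Proof. by rewrite size_image card_ord. Qed.

Lemma class_types_list c : type_lists k (class_types c).
Proof.
split=> [|H /mapP[j _ ->]]; first exact: size_class_types.
by apply: reps_rep; exact: abseq_all_pi.
Qed.

Lemma class_types_seq c (j : 'I_k) :
  type_seq (class_types c) j.+1 = rep (class_repr c j).
Proof.
rewrite /type_seq size_class_types -[(k - j.+1)%N]/(nat_of_ord (rev_ord j)).
by rewrite (nth_map j) ?size_enum_ord // nth_ord_enum rev_ordK.
Qed.

Lemma class_typesE (l : seq finAbGroup) : type_lists k l ->
  [set: isoclass k P] `&` class_types @^-1` [set l] = with_types (type_seq l).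
Proof.
move=> [sl lP]; apply/seteqP; split=> c /=.
  move=> [_ <-]; exists (class_repr c); last exact: class_reprK.
  by move=> j; rewrite class_types_seq; exact: rep_iso.
move=> [G GB <-]; split=> //; set c' := isoclass_of G.
apply: (@eq_from_nth _ trivial_group); first by rewrite size_class_types.
rewrite size_class_types => m mk.
have E (i : 'I_k) : type_seq (class_types c') i.+1 = type_seq l i.+1.
  rewrite class_types_seq.
  have [rl _] : reps P (type_seq l i.+1).
    by apply: lP; rewrite mem_nth // sl ltn_subrL (leq_ltn_trans _ (ltn_ord i)).
  rewrite -rl; apply: rep_eq; apply: isomorphic_trans (GB i).
  have [f [fi _]] := class_repr_iso G.
  by apply/isomorphicP; exists (f i); have /misom_setTP[] := fi i.
(* [type_seq] reads lists from the end, so entry [m] is recovered at the reversed index. *)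
have := E (rev_ord (Ordinal mk)).
have mE : (k - (rev_ord (Ordinal mk)).+1)%N = m by rewrite subnS subKn.
by rewrite /type_seq size_class_types sl mE.
Qed.

Lemma cl_const_ge0 : 0 <= cl_const R k P.
Proof. by rewrite cl_constE exprn_ge0 // ltW // mass_gt0. Qed.

Lemma class_mass_ge0 (c : isoclass k P) : 0 <= class_mass R c.
Proof. by rewrite divr_ge0 // cl_const_ge0. Qed.

(** The classes are sorted by their lists of types. A list has mass [cl_const] times its weight, and
    [cl_const = mass ^+ k] cancels against the total weight [mass^-1 ^+ k]. *)
Lemma class_measureT : class_measure R [set: isoclass k P] = 1%E.
Proof.
have cl0 : 0 < cl_const R k P by rewrite cl_constE exprn_gt0 // mass_gt0.
rewrite /class_measure (esum_fiber (C := type_lists k) (f := class_types)).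
- transitivity (\esum_(l in type_lists k)
      ((cl_const R k P)%:E * (list_weight l)%:E))%E.
    apply: eq_esum => l lk; have [sl lP] := lk; rewrite class_typesE //.
    rewrite esum_with_types_finab ?list_weightE ?sl ?ltW //.
      by rewrite /type_seq subn0 nth_default ?trivial_card.
    move=> i ik; have [] // : reps P (type_seq l i.+1).
    by apply: lP; rewrite mem_nth // sl ltn_subrL (leq_ltn_trans _ (ltn_ord i)).
  rewrite esumZl // => [|l _]; last by rewrite lee_fin list_weight_ge0.
  rewrite esum_list_weight -EFinM cl_constE -exprMn divff ?expr1n //.
  by rewrite gt_eqF // mass_gt0.
- by move=> c _; exact: class_types_list.
by move=> c _; rewrite lee_fin class_mass_ge0.
Qed.

Let class_measure0 : class_measure R (@set0 (isoclass k P)) = 0%E.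
Proof. exact: esum_set0. Qed.

Let class_measure_ge0 (A : set (isoclass k P)) : (0 <= class_measure R A)%E.
Proof. by apply: esum_ge0 => c _; rewrite lee_fin class_mass_ge0. Qed.

Let class_measure_sigma_additive :
  semi_sigma_additive (@class_measure R k P).
Proof.
move=> F _ tF _; rewrite /class_measure nneseries_sum_bigcup //; last first.
  by move=> c; rewrite lee_fin class_mass_ge0.
by apply: is_cvg_nneseries => n _ _; apply: esum_ge0 => c _;
  rewrite lee_fin class_mass_ge0.
Qed.

HB.instance Definition _ := isMeasure.Build _ _ R (@class_measure R k P)
  class_measure0 class_measure_ge0 class_measure_sigma_additive.

HB.instance Definition _ := Measure_isProbability.Build _ _ R
  (@class_measure R k P) class_measureT.

Lemma class_probability : exists Pr : probability (isoclass k P) R,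
  forall A, Pr A = class_measure R A.
Proof. by exists (@class_measure R k P). Qed.

End Length.
End TotalMass.

Theorem theorem1p3 (R : realType) (k : nat) (k_ge1 : (1 <= k)%N)
    (P : {fset nat}) (P_prime : forall p : nat, p \in P -> prime p) :
  exists Pr : probability (isoclass k P) R,
    [/\ (forall G : abseq k P,
           Pr [set isoclass_of G] =
             (cl_const R k P / (card_seqaut G)%:R)%:E),
        (forall A : set (isoclass k P),
           Pr A = (\esum_(c in A) Pr [set c])%E)
      & (forall B : nat -> finGroupType,
           #|B 0%N| = 1%N ->
           (forall i : nat, (1 <= i <= k)%N ->
              abelian_group (B i) /\ pi_group P (B i)) ->
           Pr [set isoclass_of G | G in
                [set G : abseq k P | forall j : 'I_k,
                   isomorphic (G j) (B j.+1)]] =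
             (cl_const R k P *
              \prod_(1 <= i < k.+1)
                 ((card_sur (B i) (B i.-1))%:R / (card_aut (B i))%:R))%:E)].
Proof.
have [Pr PrE] := class_probability R P_prime k; exists Pr.
have Pr1 c : Pr [set c] = (class_mass R c)%:E.
  by rewrite PrE /class_measure esum_set1 // lee_fin class_mass_ge0.
split=> [G|A|B B0 BP].
- by rewrite Pr1 class_massE.
- by rewrite PrE; apply: eq_esum => c _; rewrite Pr1.
rewrite PrE; apply: esum_with_types => //; exact: cl_const_ge0.
Qed.
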